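(* Let $\{R_\alpha\}_{\alpha\in(0,\alpha_0)}$ be a family of spectral regularization operators for $Tx=y$, $R_\alpha=g_\alpha(T^*T)T^*$, with $r_\alpha(\lambda):=1-\lambda g_\alpha(\lambda)$, and let $\rho:(0,\|T\|^2]\to(0,\infty)$ be a strictly increasing continuous function such that: $\rho$ is of local upper type $\beta$ for some $\beta\ge0$; $\rho$ is maximal qualification of $\{R_\alpha\}_{\alpha\in(0,\alpha_0)}$; and there exist positive constants $a$ and $k$ such that $\dfrac{\rho(\lambda)|r_\alpha(\lambda)|}{\rho(\alpha)}\ge a$ for all $\alpha,\lambda$ with $0<k\alpha\le\lambda\le\|T\|^2$. If for some $x\in X$, $\|R_\alpha Tx-x\|=O(\rho(\alpha))$ as $\alpha\to0^+$, then $x\in\mathcal{R}(\rho(T^*T))$.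
   Context: Setting. $X,Y$ are infinite dimensional Hilbert spaces, $T:X\to Y$ is a bounded linear operator with non-closed range, and $T$ is injective. $\{E_\lambda\}$ is the spectral family of $T^*T$; $f(T^*T)=\int f(\lambda)\,dE_\lambda$. A family of spectral regularization operators for $Tx=y$ is a family $R_\alpha=g_\alpha(T^*T)T^*$, $\alpha\in(0,\alpha_0)$, where $g_\alpha:[0,\|T\|^2]\to\mathbb{R}$ satisfy: (H1) each $g_\alpha$ is piecewise continuous on $[0,\|T\|^2]$; (H2) there is $C>0$ independent of $\alpha$ with $|\lambda g_\alpha(\lambda)|\le C$ for all $\lambda\in[0,\|T\|^2]$; (H3) $\lim_{\alpha\to0^+}g_\alpha(\lambda)=1/\lambda$ for every $\lambda\in(0,\|T\|^2]$. Conditions involving $\alpha$ are understood for $\alpha\in(0,\alpha_0)$, with implicitly $\alpha_0\le\|T\|^2$ so that $\rho(\alpha)$ is defined. A function $\rho:(0,\|T\|^2]\to(0,\infty)$ is qualification of $\{R_\alpha\}$ if $\rho$ is increasing and there is $\gamma>0$ with $\sup_{\lambda\in(0,\|T\|^2]}|r_\alpha(\lambda)|\rho(\lambda)\le\gamma\rho(\alpha)$ for every $\alpha\in(0,\alpha_0)$; it is maximal qualification if, moreover, for every $\lambda\in(0,\|T\|^2]$ there is $c(\lambda)>0$ with $\inf_{\alpha\in(0,\alpha_0)}|r_\alpha(\lambda)|/\rho(\alpha)\ge c(\lambda)$. A continuous non-decreasing function $\rho:(0,b]\to(0,+\infty)$ with $\lim_{t\to0^+}\rho(t)=0$ is of local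 upper type $\beta\ge0$ if there is $d>0$ with $\rho(t)\le d\,(1/s)^\beta\rho(st)$ for every $s\in(0,1]$, $t\in(0,b]$. *)

(* Defs.v *)
From HB Require Import structures.
From mathcomp Require Import all_boot all_order all_algebra sesquilinear.
From mathcomp Require Import complex.
From mathcomp Require Import all_classical all_reals all_analysis.

Set Implicit Arguments.
Unset Strict Implicit.
Unset Printing Implicit Defensive.

Import Order.TTheory GRing.Theory Num.Theory.
Import numFieldNormedType.Exports.

Local Open Scope classical_set_scope.
Local Open Scope ring_scope.

(* The scalar field of a Hilbert space is R or R[i]; the two cases are treated
   uniformly. *)
Variant scalar_kind := RealScalars | ComplexScalars.

Definition scalars (R : realType) (k : scalar_kind) : numFieldType :=
  match k with RealScalars => R | ComplexScalars => R[i]%C end.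

Definition sconj (R : realType) (k : scalar_kind) : scalars R k -> scalars R k :=
  match k with RealScalars => fun z => z | ComplexScalars => @conjc R end.

Definition sRe (R : realType) (k : scalar_kind) : scalars R k -> R :=
  match k with RealScalars => fun z => z | ComplexScalars => @complex.Re R end.

Record hilbert (R : realType) (k : scalar_kind) := Hilbert {
  hilbert_sort :> completeNormedModType (scalars R k);
  hdot : {dot hilbert_sort for @sconj R k};
  hdotE : forall x : hilbert_sort, `|x| ^+ 2 = hdot x x }.

Arguments hdot {R k h}.

Section hilbert_defs.
Context {R : realType} {k : scalar_kind}.
Implicit Types H : hilbert R k.

(* Norms of a normed module over [scalars R k] take values in that field. *)
Definition hnorm H (x : H) : R := sRe `|x|.

Definition infinite_dimensional H :=
  forall s : seq H, exists x : H, forall c : nat -> scalars R k,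
    x <> \sum_(i < size s) c i *: s`_i.

Definition is_adjoint (X Y : hilbert R k) (T : X -> Y) (Tstar : Y -> X) :=
  forall x y, hdot (T x) y = hdot x (Tstar y).

Definition opnorm (X Y : hilbert R k) (T : X -> Y) : R :=
  sup [set hnorm (T x) | x in [set x : X | hnorm x <= 1]].

End hilbert_defs.

(* [sf_sym] and [sf_mul] (at l = m) make each E l an orthogonal projection. *)
Record spectral_family (R : realType) (k : scalar_kind) (H : hilbert R k) :=
  SpectralFamily {
  sf_fun :> R -> {linear H -> H};
  sf_sym : forall l x y, hdot (sf_fun l x) y = hdot x (sf_fun l y);
  sf_mul : forall l m x, sf_fun l (sf_fun m x) = sf_fun (Num.min l m) x;
  sf_right_continuous : forall l x, sf_fun m x @[m --> l^'+] --> sf_fun l x;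
  sf_ninfty : forall x, sf_fun m x @[m --> -oo] --> (0 : H);
  sf_pinfty : forall x, sf_fun m x @[m --> +oo] --> x }.

Section spectral_cdf.
Context {R : realType} {k : scalar_kind} {H : hilbert R k}.
Variables (E : spectral_family H) (x : H).

(* The distribution function l |-> |E_l x|^2 = <E_l x, x>. *)
Definition spectral_cdf (l : R) : R := hnorm (E l x) ^+ 2.

Lemma hnorm_sqr (y : H) : hnorm y ^+ 2 = sRe (hdot y y).
Proof.
rewrite -hdotE /hnorm; have := normr_ge0 y; move: (`|y|); clear.
case: k => //= -[a b]; rewrite lecE /= => /andP[/eqP -> _].
by rewrite expr2 mul0r subr0.
Qed.

Lemma sRe_ge0 (z : scalars R k) : 0 <= z -> 0 <= sRe z.
Proof. by case: k z => //= z; rewrite lecE /= => /andP[]. Qed.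

Lemma sReD (z w : scalars R k) : sRe (z + w) = sRe z + sRe w.
Proof. by case: k z w => //= -[a b] [c d]. Qed.

Lemma sRe_dist (z w : scalars R k) : `|sRe z - sRe w| <= sRe `|z - w|.
Proof.
case: k z w => //= -[a b] [c d] /=.
by rewrite -sqrtr_sqr ler_sqrt ?lerDl ?sqr_ge0 // addr_ge0 ?sqr_ge0.
Qed.

Lemma sRe_small (e : R) : 0 < e ->
  exists2 d : scalars R k, 0 < d & forall z, z < d -> sRe z < e.
Proof.
case: k => /= e0; first by exists e.
by exists (e%:C)%C; [rewrite ltcE /= eqxx | move=> z; rewrite ltcE /= => /andP[]].
Qed.

Lemma continuous_sRe : continuous (@sRe R k).
Proof.
move=> z A /nbhs_ballP[e /= /sRe_small[d d0 de] eA].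
apply/nbhs_ballP; exists d => //= w zw.
by apply: eA; apply: le_lt_trans (sRe_dist z w) (de _ zw).
Qed.

Lemma spectral_cdf_nondecreasing : nondecreasing spectral_cdf.
Proof.
move=> l m lm; rewrite /spectral_cdf !hnorm_sqr.
rewrite !sf_sym !sf_mul !minxx.
set d := E m x - E l x.
have -> : hdot x (E m x) = hdot x (E l x) + hdot d d.
  have -> : hdot d d = hdot x d.
    rewrite {1}/d linearBl /= !sf_sym -linearBr /= /d !linearB /= !sf_mul minxx.
    by rewrite minxx (min_idPr lm) (min_idPl lm) subrr addr0.
  by rewrite -linearD /= /d addrC subrK.
by rewrite sReD lerDl sRe_ge0 // -hdotE exprn_ge0.
Qed.

Lemma spectral_cdf_right_continuous : right_continuous spectral_cdf.
Proof.
move=> l; rewrite /spectral_cdf.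
have c : hnorm (E m x) @[m --> l^'+] --> hnorm (E l x).
  apply: (@cvg_comp _ _ _ (fun m => `|E m x|) (@sRe R k) _ (nbhs `|E l x|)); last exact: continuous_sRe.
  by apply: cvg_norm; exact: sf_right_continuous.
by rewrite expr2; exact: (cvgM c c).
Qed.

HB.instance Definition _ := isCumulative.Build R _ R spectral_cdf
  spectral_cdf_nondecreasing spectral_cdf_right_continuous.

Definition spectral_measure := lebesgue_stieltjes_measure spectral_cdf.

End spectral_cdf.

Section functional_calculus.
Context {R : realType} {k : scalar_kind} {H : hilbert R k}.
Variables (E : spectral_family H) (D : set R) (f : R -> R).

(* Domain of the (possibly unbounded) operator \int_D f dE. *)
Definition spectral_domain : set H :=
  [set x | measurable_fun D f /\
     (spectral_measure E x).-integrable D (fun l => (f l ^+ 2)%:E)].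

(* \int_D f d Re<E x, y>, by polarization. *)
Definition spectral_form (x y : H) : R :=
  4^-1 * (\int[spectral_measure E (x + y)]_(l in D) f l
          - \int[spectral_measure E (x - y)]_(l in D) f l).

(* The graph of \int_D f dE: z = (\int_D f dE) x iff x is in the domain and
   <z, y> = \int_D f d<E x, y> for all y in the domain, which is a dense
   subspace. The real parts suffice: in the complex case, replace y by 'i y. *)
Definition spectral_integral (x z : H) : Prop :=
  spectral_domain x /\
  forall y, spectral_domain y -> sRe (hdot z y) = spectral_form x y.

End functional_calculus.

Definition is_spectral_family_of (R : realType) (k : scalar_kind)
    (H : hilbert R k) (E : spectral_family H) (A : H -> H) :=
  forall x, spectral_integral E setT (fun l => l) x (A x).

Section regularization.
Context {R : realType}.
Implicit Types (a b : R) (g : R -> R -> R) (rho : R -> R).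

(* Continuity off a finite set, with finite one-sided limits everywhere. *)
Definition piecewise_continuous a b (f : R -> R) :=
  [/\ exists s : seq R, forall x, x \in `]a, b[ -> x \notin s ->
        {for x, continuous f},
      forall x, x \in `[a, b[ -> cvg (f y @[y --> x^'+]) &
      forall x, x \in `]a, b] -> cvg (f y @[y --> x^'-])].

(* In the following, b stands for |T|^2, and functions on `[0, b] or `]0, b]
   are represented by functions on R whose other values are irrelevant. *)

Record spectral_generator b (alpha0 : R) g : Prop := SpectralGenerator {
  sg_piecewise : forall al, al \in `]0, alpha0[ ->
    piecewise_continuous 0 b (g al);
  sg_bounded : exists2 C : R, 0 < C & forall al, al \in `]0, alpha0[ ->
    forall l, l \in `[0, b] -> `|l * g al l| <= C;
  sg_limit : forall l, l \in `]0, b] -> g al l @[al --> 0^'+] --> l^-1 }.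

Definition residual g al l : R := 1 - l * g al l.

Definition qualification b (alpha0 : R) g rho :=
  [/\ {in `]0, b], forall l, 0 < rho l},
      {in `]0, b] &, {homo rho : l m / l <= m}} &
      exists2 gamma : R, 0 < gamma & forall al, al \in `]0, alpha0[ ->
        (ereal_sup [set (`|residual g al l| * rho l)%:E | l in `]0%R, b]]
          <= (gamma * rho al)%:E)%E].

Definition maximal_qualification b (alpha0 : R) g rho :=
  qualification b alpha0 g rho /\
  forall l, l \in `]0, b] -> exists2 c : R, 0 < c &
    (c%:E <= ereal_inf
       [set (`|residual g al l| / rho al)%:E | al in `]0%R, alpha0[])%E.

Definition local_upper_type b rho (beta : R) :=
  [/\ {in `]0, b], forall t, 0 < rho t},
      {within `]0, b], continuous rho},
      {in `]0, b] &, {homo rho : t u / t <= u}},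
      rho t @[t --> 0^'+] --> (0 : R) &
      0 <= beta /\ exists2 d : R, 0 < d & forall s t,
        s \in `]0, 1] -> t \in `]0, b] ->
        rho t <= d * (s^-1 `^ beta) * rho (s * t)].

End regularization.

(* R_al = g_al(T^* T) T^* for al in ]0, alpha0[. *)
Definition spectral_regularization (R : realType) (k : scalar_kind)
    (X Y : hilbert R k) (T : X -> Y) (Tstar : Y -> X) (E : spectral_family X)
    (alpha0 : R) (g : R -> R -> R) (Ra : R -> Y -> X) :=
  spectral_generator (opnorm T ^+ 2) alpha0 g /\
  forall al, al \in `]0, alpha0[ -> forall y,
    spectral_integral E `[0, opnorm T ^+ 2] (g al) (Tstar y) (Ra al y).

(* Main.v *)
(* Let mu be the spectral measure of x and r_al the residual. Since
   |R_al T x - x|^2 = \int r_al^2 dmu = O(rho(al)^2) while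
   |r_al| >= a rho(al) / rho on [kappa al, |T|^2], the integral of rho^-2 over
   [kappa al, |T|^2] is bounded by a constant independent of al. Letting al tend
   to 0, rho^-2 is mu-integrable on ]0, |T|^2], which carries mu because T is
   injective. Hence w = rho(T^*T)^-1 x exists, as the limit of the truncated
   integrals (\int_]e, |T|^2] rho^-1 dE) x, and rho(T^*T) w = x.

   Bounded measurable functions of T^*T are obtained from a functional monotone
   class argument: the functions f for which (\int f dE) x exists contain the
   indicators of the rays ]-oo, l] (with value E_l x) and are closed under linear
   combinations and bounded pointwise limits, by completeness and the isometry
   |(\int f dE) x|^2 = \int f^2 dmu. *)
Require Import Defs.
From HB Require Import structures.
From mathcomp Require Import all_boot all_order all_algebra sesquilinear.
From mathcomp Require Import complex.
From mathcomp Require Import all_classical all_reals all_analysis.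
From mathcomp Require Import measurable_realfun ring lra.

Set Implicit Arguments.
Unset Strict Implicit.
Unset Printing Implicit Defensive.

Import Order.TTheory GRing.Theory Num.Theory.
Import numFieldNormedType.Exports.

Local Open Scope classical_set_scope.
Local Open Scope ring_scope.

(** * The real inner product of a real or complex Hilbert space *)

Section real_inner_product.
Context {R : realType} {k : scalar_kind}.

Definition sreal (c : R) : scalars R k :=
  match k with RealScalars => c | ComplexScalars => (c%:C)%C end.

Lemma sRe_srealM (c : R) (z : scalars R k) : sRe (sreal c * z) = c * sRe z.
Proof. by rewrite /sreal; case: k z => //= -[a b] /=; rewrite mul0r subr0. Qed.

Lemma sRe_conj (z : scalars R k) : sRe (sconj z) = sRe z.
Proof. by case: k z => //= -[a b]. Qed.

Lemma sRe_gt0 (e : scalars R k) : 0 < e -> 0 < sRe e.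
Proof. by case: k e => //= e; rewrite ltcE /= => /andP[]. Qed.

Lemma sRe_lt (z e : scalars R k) : 0 <= z -> 0 < e -> sRe z < sRe e -> z < e.
Proof.
case: k z e => //= z e; rewrite lecE ltcE => /andP[/= /eqP z0 _] /andP[/= /eqP e0 _] ze.
by rewrite ltcE /= z0 e0 eqxx.
Qed.

Context {H : hilbert R k}.
Implicit Types x y z : H.

Definition rdot x y : R := sRe (hdot x y).

Lemma hnorm_rdot x : hnorm x ^+ 2 = rdot x x.
Proof. exact: hnorm_sqr. Qed.

Lemma rdotC x y : rdot x y = rdot y x.
Proof.
have hC : hdot x y = sconj (hdot y x).
  by have := hermitian_subproof (s := hdot) x y; rewrite expr0 mul1r.
by rewrite /rdot hC sRe_conj.
Qed.

Lemma rdotDl x y z : rdot (x + y) z = rdot x z + rdot y z.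
Proof. by rewrite /rdot linearDl sReD. Qed.

Lemma rdotDr x y z : rdot x (y + z) = rdot x y + rdot x z.
Proof. by rewrite rdotC rdotDl !(rdotC x). Qed.

Lemma rdot0l x : rdot 0 x = 0.
Proof. by apply: (@addIr _ (rdot 0 x)); rewrite -rdotDl !add0r. Qed.

Lemma rdotNl x y : rdot (- x) y = - rdot x y.
Proof. by apply/eqP; rewrite -addr_eq0 -rdotDl addNr rdot0l. Qed.

Lemma rdotBl x y z : rdot (x - y) z = rdot x z - rdot y z.
Proof. by rewrite rdotDl rdotNl. Qed.

Lemma rdotBr x y z : rdot x (y - z) = rdot x y - rdot x z.
Proof. by rewrite rdotC rdotBl !(rdotC x). Qed.

Lemma rdotNr x y : rdot x (- y) = - rdot x y.
Proof. by rewrite rdotC rdotNl rdotC. Qed.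

Lemma rdotZl c x y : rdot (sreal c *: x) y = c * rdot x y.
Proof. by rewrite /rdot linearZl_LR /= sRe_srealM. Qed.

Lemma rdotZr c x y : rdot x (sreal c *: y) = c * rdot x y.
Proof. by rewrite rdotC rdotZl rdotC. Qed.

Lemma hnorm_ge0 x : 0 <= hnorm x.
Proof. exact: sRe_ge0. Qed.

Lemma hnorm0 : hnorm (0 : H) = 0.
Proof. by rewrite /hnorm normr0; case: k. Qed.

Lemma hnorm0_eq0 x : hnorm x = 0 -> x = 0.
Proof.
move=> x0; apply/eqP; rewrite -normr_le0.
have := normr_ge0 x; move: x0; rewrite /hnorm; move: `|x|; clear.
by case: k => //= [x -> //|[a b]] /= ->; rewrite !lecE /= => /andP[/eqP -> _]; rewrite eqxx lexx.
Qed.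

Lemma hnorm_opp x : hnorm (- x) = hnorm x.
Proof. by rewrite /hnorm normrN. Qed.

Lemma ler_hnormD x y : hnorm (x + y) <= hnorm x + hnorm y.
Proof.
rewrite /hnorm -sReD -{1}[`|x| + `|y|](subrK `|x + y|) sReD lerDr.
by apply: sRe_ge0; rewrite subr_ge0 ler_normD.
Qed.

(** Cauchy-Schwarz: for y <> 0, expand 0 <= |x - t y|^2 at its minimizer t = <x, y> / |y|^2. *)
Lemma rdot_le x y : `|rdot x y| <= hnorm x * hnorm y.
Proof.
wlog xy : x / 0 <= rdot x y.
  move=> h; case: (leP 0 (rdot x y)) => [|xy]; first exact: h.
  by rewrite -normrN -rdotNl -[hnorm x]hnorm_opp h // rdotNl oppr_ge0 ltW.
rewrite ger0_norm //.
have [y0|y0] := eqVneq (hnorm y) 0.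
  by rewrite (hnorm0_eq0 y0) rdotC rdot0l mulr_ge0 // hnorm_ge0.
rewrite -ler_sqr ?nnegrE ?mulr_ge0 ?hnorm_ge0 // exprMn.
pose t := rdot x y / hnorm y ^+ 2.
have := sqr_ge0 (hnorm (x - sreal t *: y)).
rewrite hnorm_rdot rdotBl !rdotBr !rdotZl !rdotZr -!hnorm_rdot (rdotC y x).
have y2 : 0 < hnorm y ^+ 2 by rewrite exprn_gt0 // lt_neqAle eq_sym y0 hnorm_ge0.
suff -> : hnorm x ^+ 2 - t * rdot x y - (t * rdot x y - t * (t * hnorm y ^+ 2))
   = hnorm x ^+ 2 - rdot x y ^+ 2 / hnorm y ^+ 2.
  by rewrite subr_ge0 ler_pdivrMr.
by rewrite /t; field.
Qed.

Lemma cvg_hnorm (I : Type) (F : set_system I) (FF : Filter F) (f : I -> H) z :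
  f i @[i --> F] --> z -> hnorm (f i) @[i --> F] --> hnorm z.
Proof.
move=> fz; apply: (@cvg_comp _ _ _ (fun i => `|f i|) (@sRe R k) _ (nbhs `|z|)).
  exact: cvg_norm.
exact: continuous_sRe.
Qed.

(** A Cauchy sequence for the real-valued [hnorm] is Cauchy for the norm with values in
    [scalars R k]: [sRe_gt0] and [sRe_lt] compare the two. *)
Lemma hilbert_complete (u : nat -> H) :
  (forall e : R, 0 < e -> \forall m & n \near \oo, hnorm (u m - u n) < e) ->
  exists z, hnorm (u n - z) @[n --> \oo] --> (0 : R).
Proof.
move=> hu; have /cauchy_cvgP uz : cauchy (u n @[n --> \oo]).
  apply/cauchy_ballP => e e0; have := hu _ (sRe_gt0 e0).
  rewrite near_map2 => hN; apply: filterS hN.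
  by move=> [m n] /= mn; rewrite -ball_normE /=; exact: sRe_lt.
have zc : u n @[n --> \oo] --> lim (u n @[n --> \oo]) by [].
exists (lim (u n @[n --> \oo])).
rewrite (_ : 0 = @hnorm R k H (lim (u n @[n --> \oo]) - lim (u n @[n --> \oo]))).
  by apply: cvg_hnorm; apply: cvgB => //; exact: cvg_cst.
by rewrite subrr hnorm0.
Qed.

Lemma cvg_rdot (u : nat -> H) z y : hnorm (u n - z) @[n --> \oo] --> (0 : R) ->
  rdot (u n) y @[n --> \oo] --> rdot z y.
Proof.
move=> uz; apply/cvgrPdistC_le => e e0.
have e1 : 0 < e / (hnorm y + 1) by rewrite divr_gt0 // ltr_wpDl // hnorm_ge0.
move/cvgrPdistC_le: uz => /(_ _ e1); apply: filterS => n.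
rewrite subr0 -rdotBl => h; apply: (le_trans (rdot_le _ _)).
move: h; rewrite ger0_norm ?hnorm_ge0 // ler_pdivlMr ?ltr_wpDl ?hnorm_ge0 //.
by apply: le_trans; rewrite ler_wpM2l ?hnorm_ge0 // lerDl.
Qed.

End real_inner_product.

(** * Bounded Borel functions and a functional monotone class theorem *)

Section bounded_measurable.
Context {R : realType}.
Import HBSimple HBNNSimple.
Implicit Types f g : R -> R.

Definition bmeas f := measurable_fun [set: R] f /\ exists M : R, forall t, `|f t| <= M.

Lemma bmeas_measurable f : bmeas f -> measurable_fun [set: R] f.
Proof. by case. Qed.

Lemma bmeas_indic (A : set R) : measurable A -> bmeas \1_A.
Proof.
move=> mA; split; first exact: measurable_indic.
by exists 1 => t; rewrite indicE; case: (_ \in _); rewrite ?normr1 ?normr0.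
Qed.

Lemma bmeas_cst c : bmeas (cst c).
Proof. by split; [exact: measurable_cst|exists `|c|]. Qed.

Lemma bmeasD f g : bmeas f -> bmeas g -> bmeas (f \+ g).
Proof.
move=> [mf [M fM]] [mg [N gN]]; split; first exact: measurable_funD.
by exists (M + N) => t; rewrite (le_trans (ler_normD _ _)) // lerD.
Qed.

Lemma bmeasM f g : bmeas f -> bmeas g -> bmeas (f \* g).
Proof.
move=> [mf [M fM]] [mg [N gN]]; split; first exact: measurable_funM.
by exists (M * N) => t; rewrite /= normrM ler_pM.
Qed.

Lemma bmeasZ c f : bmeas f -> bmeas (fun t => c * f t).
Proof. by move=> bf; apply: bmeasM => //; exact: bmeas_cst. Qed.

Lemma bmeasB f g : bmeas f -> bmeas g -> bmeas (f \- g).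
Proof.
move=> bf bg; rewrite (_ : _ \- _ = f \+ (fun t => -1 * g t)).
  by apply: bmeasD => //; exact: bmeasZ.
by apply/funext => t /=; rewrite mulN1r.
Qed.

Lemma cvg_indic_bigcup (F : (set R)^nat) t : nondecreasing_seq F ->
  (\1_(F n) t : R) @[n --> \oo] --> (\1_(\bigcup_n F n) t : R).
Proof.
move=> ndF; have [/= [n _ Fnt]|h] := pselect ((\bigcup_n F n) t).
  apply: cvg_near_cst; exists n => // m /= nm.
  by rewrite !indicE !mem_set //; [exists n|move/subsetPset: (ndF _ _ nm); exact].
apply: cvg_near_cst; apply: nearW => n.
by rewrite !indicE !memNset // => Fnt; apply: h; exists n.
Qed.

(** Rays give half-open intervals, a pi-system generating the Borel sets; Dynkin's theorem then
    gives all indicators, linearity the simple functions, and limits the bounded functions. *)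
Lemma bmeas_monotone_class (C : (R -> R) -> Prop) :
  (forall l, C \1_`]-oo, l]) ->
  (forall c f g, bmeas f -> bmeas g -> C f -> C g -> C (fun t => c * f t + g t)) ->
  (forall (F : nat -> R -> R) f (M : R), (forall n, bmeas (F n)) ->
    (forall n t, `|F n t| <= M) -> bmeas f ->
    (forall t, F n t @[n --> \oo] --> f t) -> (forall n, C (F n)) -> C f) ->
  forall f, bmeas f -> C f.
Proof.
move=> Cray Clin Clim.
have mray (l : R) : bmeas \1_`]-oo, l].
  by apply: bmeas_indic; exact: measurable_itv.
have C0 : C (cst 0).
  rewrite (_ : cst 0 = (fun t : R => -1 * \1_`]-oo, 0] t + \1_`]-oo, 0] t)).
    exact: Clin.
  by apply/funext => t /=; rewrite mulN1r addNr.
have C1 : C (cst 1).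
  apply: (Clim (fun n : nat => \1_`]-oo, n%:R]) _ 1) => //.
  - by move=> n t; rewrite indicE; case: (_ \in _); rewrite ?normr1 ?normr0.
  - exact: bmeas_cst.
  - move=> t; apply: cvg_near_cst; 
    exists (Num.bound `|t|) => // m /= nm; rewrite indicE mem_set //= in_itv /=.
    by rewrite (le_trans (ler_norm t)) // (le_trans (ltW (archi_boundP (normr_ge0 t)))) ?ler_nat.
(* The sets whose indicator is in [C] form a lambda-system: differences use [Clin], increasing
   unions use [Clim]. *)
have CA : forall A : set R, measurable A -> C \1_A.
  pose K : set (set R) := [set A | measurable A /\ C \1_A].
  suff : (R.-ocitv.-measurable).-sigma.-measurable `<=` K by move=> h A /h[].
  apply: (@lambda_system_subset _ _ (@ocitvI R)) => //; first split => //.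
  - by split; [exact: measurableT|rewrite indicT].
  - move=> A B BA [mA CA] [mB CB]; split; first exact: measurableD.
    rewrite (_ : \1_(A `\` B) = (fun t : R => -1 * \1_B t + \1_A t)).
      by apply: Clin => //; exact: bmeas_indic.
    apply/funext => t; rewrite !indicE in_setD.
    have [tB|tB] := boolP (t \in B); last by rewrite andbT mulr0 add0r.
    have -> : t \in A by move: tB; rewrite !inE; exact: BA.
    by rewrite /= mulN1r addNr.
  - move=> F ndF KF; split; first by apply: bigcupT_measurable => n; have [] := KF n.
    apply: (Clim (fun n => \1_(F n)) _ 1) => //.
    + by move=> n; apply: bmeas_indic; have [] := KF n.
    + by move=> n t; rewrite indicE; case: (_ \in _); rewrite ?normr1 ?normr0.
    + by apply: bmeas_indic; apply: bigcupT_measurable => n; have [] := KF n.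
    + by move=> t; exact: cvg_indic_bigcup.
    + by move=> n; have [] := KF n.
  - move=> A /ocitvP[->|[[a b] /= ab ->]].
      by split; [exact: measurable0|rewrite indic0].
    split; first exact: measurable_itv.
    rewrite (_ : \1__ = (fun t : R => -1 * \1_`]-oo, a] t + \1_`]-oo, b] t)); last first.
      apply/funext => t; rewrite !indicE !mem_setE !in_itv /=.
      by have [ta|ta] := leP t a; rewrite /= ?mulr0 ?add0r // (le_trans ta (ltW ab)) mulN1r addNr.
    exact: Clin.
(* Boundedness and membership go together in the induction, as [Clin] asks for both. *)
have Csum (I : Type) (s : seq I) (c : I -> R) (A : I -> set R) :
    (forall i, measurable (A i)) ->
    bmeas (fun t => \sum_(i <- s) c i * \1_(A i) t) /\ C (fun t => \sum_(i <- s) c i * \1_(A i) t).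
  move=> mA; elim: s => [|i s [bs Cs]].
    rewrite (_ : (fun _ => _) = cst 0); first by split => //; exact: bmeas_cst.
    by apply/funext => t; rewrite big_nil.
  rewrite (_ : (fun _ => _) = (fun t => c i * \1_(A i) t + \sum_(i <- s) c i * \1_(A i) t)).
    split; last by apply: Clin => //; [exact: bmeas_indic|exact: CA].
    by apply: bmeasD => //; apply: bmeasZ; exact: bmeas_indic.
  by apply/funext => t; rewrite big_cons.
move=> f [mf [M fM]].
(* Adding the bound M makes f nonnegative, so that increasing simple functions approximate it; M is
   subtracted again at the end. *)
have mg : measurable_fun [set: R] (fun t => (f t + M)%:E).
  by apply/measurable_EFinP; apply: measurable_funD => //; exact: measurable_cst.
pose s n := nnsfun_approx (@measurableT _ R) mg n.
have sE n t : s n t = \sum_(y \in range (s n)) y * \1_(s n @^-1` [set y]) t.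
  exact: fimfunE.
have g0 t : (0 <= (f t + M)%:E)%E.
  by rewrite lee_fin -lerBlDr sub0r; have := fM t; rewrite ler_norml => /andP[].
have scvg t : s n t @[n --> \oo] --> f t + M.
  have /fine_cvgP[_] := @cvg_nnsfun_approx _ _ _ _ measurableT _ mg (fun t _ => g0 t) t I.
  exact.
have sC n : bmeas (s n) /\ C (s n).
  rewrite (_ : (s n : R -> R) = (fun t => \sum_(y <- finmap.enum_fset (fset_set (range (s n)))) y * \1_(s n @^-1` [set y]) t)).
    by apply: Csum => y; exact: measurable_sfunP.
  by apply/funext => t; rewrite {1}sE fsbig_finite.
(* Increasing simple functions stay below their limit f + M <= 2 M. *)
have sM n t : `|s n t| <= M + M.
  rewrite ger0_norm ?fun_ge0 //.
  apply: (@le_trans _ _ (f t + M)); last by rewrite lerD2r (le_trans (ler_norm _)).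
  have nds : nondecreasing_seq (fun m => s m t).
    by move=> i j ij; have /lefP := nd_nnsfun_approx measurableT mg ij; exact.
  by have := nondecreasing_cvgn_le nds (cvgP _ (scvg t)) n; rewrite (cvg_lim _ (scvg t)).
apply: (Clim (fun n t => - M * 1 + s n t) _ (M + (M + M))).
- by move=> n; apply: bmeasD; [apply: bmeasZ; exact: bmeas_cst|have [] := sC n].
- move=> n t; rewrite (le_trans (ler_normD _ _)) // lerD // mulr1 normrN ger0_norm //.
  exact: le_trans (fM 0).
- by split => //; exists M.
- move=> t; rewrite -[f t](addrK M) (addrC _ (- M)) -[X in X + _]mulr1.
  by apply: cvgD; [exact: cvg_cst|exact: scvg].
- by move=> n; have [? ?] := sC n; apply: Clin => //; exact: bmeas_cst.
Qed.

End bounded_measurable.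

(** * Integrals against the spectral measure of a vector *)

Section spectral_integrals.
Context {R : realType} {k : scalar_kind} {H : hilbert R k}.
Variable E : spectral_family H.
Implicit Types (x y z : H) (f g : R -> R) (l : R).

Lemma lebesgue_stieltjes_itv_oc (F : cumulative R R) (a b : R) : a <= b ->
  lebesgue_stieltjes_measure F `]a, b] = (F b - F a)%:E.
Proof.
move=> ab; rewrite /lebesgue_stieltjes_measure /measure_extension.
by rewrite measurable_mu_extE /=; [rewrite wlength_itv_bnd|exact: is_ocitv].
Qed.

(** Exhaust the ray by ]l - n, l]: the increments of the distribution function converge, since it
    tends to 0 at -oo by [sf_ninfty]. *)
Lemma spectral_measure_ray x l :
  spectral_measure E x `]-oo, l] = (spectral_cdf E x l)%:E.
Proof.
pose I n : set R := `]l - n%:R, l]%classic.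
have IE : `]-oo, l]%classic = \bigcup_n I n.
  apply/seteqP; split => [t /=|t [n _] /=]; rewrite !in_itv /= ?andbT.
    move=> tl; exists (Num.bound (l - t)) => //=; rewrite /I /= in_itv /= tl andbT.
    by rewrite ltrBlDr -ltrBlDl archi_boundP // subr_ge0.
  by move=> /andP[].
have : (spectral_measure E x \o I) n @[n --> \oo] --> (spectral_cdf E x l)%:E.
  rewrite (_ : spectral_measure E x \o I =
      (fun n => (spectral_cdf E x l - spectral_cdf E x (l - n%:R))%:E)); last first.
    apply/funext => n; rewrite /= /spectral_measure /I lebesgue_stieltjes_itv_oc //.
    by rewrite gerBl.
  apply/cvg_EFin; first exact: nearW.
  rewrite -[X in _ --> X]subr0; apply: cvgB; first exact: cvg_cst.
  have c0 : hnorm (E m x) @[m --> -oo] --> (0 : R).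
    by rewrite -(hnorm0 (H := H)); apply: cvg_hnorm; exact: sf_ninfty.
  suff h : hnorm (E (l - n%:R) x) @[n --> \oo] --> (0 : R).
    have := continuous_cvg _ (@exprn_continuous R 2 _) h; rewrite expr0n /=; exact.
  apply: (cvg_comp (fun n : nat => l - n%:R) (fun m => hnorm (E m x)) _ c0).
  apply/cvgrNyPle => A; exists (Num.bound `|l - A|) => // n /= nA.
  rewrite lerBlDr -lerBlDl (le_trans (ler_norm _)) //.
  by rewrite (le_trans (ltW (archi_boundP (normr_ge0 _)))) ?ler_nat.
have : (spectral_measure E x \o I) n @[n --> \oo] --> spectral_measure E x (\bigcup_n I n).
  apply: nondecreasing_cvg_mu; rewrite /I //; first exact: bigcup_measurable.
  move=> m n mn; apply/subsetPset/subset_itv => //.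
  by rewrite leBSide /= lerD2l lerN2 ler_nat.
by rewrite -IE; exact: cvg_unique.
Qed.

(** Exhaust the line by the rays ]-oo, n] and use [sf_pinfty]. That the mass is finite makes all
    bounded Borel functions integrable. *)
Lemma spectral_measure_setT x : spectral_measure E x setT = (hnorm x ^+ 2)%:E.
Proof.
pose I n : set R := `]-oo, n%:R]%classic.
have IE : setT = \bigcup_n I n.
  apply/seteqP; split => [t _ /=|//]; exists (Num.bound `|t|) => //=.
  by rewrite /I /= in_itv /= (le_trans (ler_norm t)) // ltW // archi_boundP.
have : (spectral_measure E x \o I) n @[n --> \oo] --> (hnorm x ^+ 2)%:E.
  rewrite (_ : spectral_measure E x \o I = (fun n => (hnorm (E n%:R x) ^+ 2)%:E)); last first.
    by apply/funext => n; rewrite /= spectral_measure_ray.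
  apply/cvg_EFin; first exact: nearW.
  have c1 : hnorm (E m x) @[m --> +oo] --> hnorm x.
    by apply: cvg_hnorm; exact: sf_pinfty.
  suff h : hnorm (E n%:R x) @[n --> \oo] --> hnorm x.
    exact: (continuous_cvg _ (@exprn_continuous R 2 _) h).
  exact: (cvg_comp (fun n : nat => n%:R) (fun m => hnorm (E m x)) cvgr_idn c1).
have : (spectral_measure E x \o I) n @[n --> \oo] --> spectral_measure E x (\bigcup_n I n).
  apply: nondecreasing_cvg_mu; rewrite /I //; first exact: bigcup_measurable.
  by move=> m n mn; apply/subsetPset/subset_itv => //; rewrite leBSide /= ler_nat.
by rewrite -IE; exact: cvg_unique.
Qed.

Definition sint x f : R := \int[spectral_measure E x]_l f l.

Lemma bmeas_integrable x f : bmeas f ->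
  (spectral_measure E x).-integrable setT (EFin \o f).
Proof.
have xoo : (spectral_measure E x setT < +oo)%E by rewrite spectral_measure_setT ltry.
move=> [mf [M fM]]; apply: measurable_bounded_integrable => //.
exists M; split; first exact: num_real.
by move=> N MN t _ /=; rewrite (le_trans (fM t)) // ltW.
Qed.

Lemma sintD x f g : bmeas f -> bmeas g -> sint x (fun t => f t + g t) = sint x f + sint x g.
Proof. by move=> bf bg; rewrite /sint RintegralD //; exact: bmeas_integrable. Qed.

Lemma sintB x f g : bmeas f -> bmeas g -> sint x (fun t => f t - g t) = sint x f - sint x g.
Proof. by move=> bf bg; rewrite /sint RintegralB //; exact: bmeas_integrable. Qed.

Lemma sintZ x c f : bmeas f -> sint x (fun t => c * f t) = c * sint x f.
Proof. by move=> bf; rewrite /sint RintegralZl //; exact: bmeas_integrable. Qed.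

Lemma sint_ge0 x f : (forall t, 0 <= f t) -> 0 <= sint x f.
Proof. by move=> f0; exact: Rintegral_ge0. Qed.

Lemma le_sint x f g : bmeas f -> bmeas g -> (forall t, f t <= g t) -> sint x f <= sint x g.
Proof. by move=> bf bg fg; apply: le_Rintegral => //; exact: bmeas_integrable. Qed.

Lemma sint_indic x (A : set R) : measurable A -> sint x \1_A = fine (spectral_measure E x A).
Proof. by move=> mA; rewrite /sint /Rintegral integral_indic // setIT. Qed.

Lemma sint_ray x l : sint x \1_`]-oo, l] = hnorm (E l x) ^+ 2.
Proof. by rewrite sint_indic ?spectral_measure_ray. Qed.

Lemma sint1 x : sint x (cst 1) = hnorm x ^+ 2.
Proof. by rewrite -indicT sint_indic ?spectral_measure_setT. Qed.

Lemma cvg_Rintegral_dominated x (F : nat -> R -> R) f g :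
  (forall n, measurable_fun [set: R] (F n)) -> measurable_fun [set: R] f ->
  (forall t, F n t @[n --> \oo] --> f t) ->
  (spectral_measure E x).-integrable setT (EFin \o g) ->
  (forall n t, `|F n t| <= g t) ->
  (spectral_measure E x).-integrable setT (EFin \o f) /\
  sint x (F n) @[n --> \oo] --> sint x f.
Proof.
move=> mF mf Ff ig Fg.
have mF' n : measurable_fun [set: measurableTypeR R] (EFin \o F n).
  by apply/measurable_EFinP; exact: mF.
have mf' : measurable_fun [set: measurableTypeR R] (EFin \o f).
  by apply/measurable_EFinP.
have [||if_ _ h] := dominated_convergence (mu := spectral_measure E x)
  measurableT mF' mf' _ ig.
- apply: aeW => t _; apply/cvg_EFin; first exact: nearW.
  exact: Ff.
- by apply: aeW => t n _; exact: Fg.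
split => //; rewrite /sint /Rintegral.
by apply: fine_cvg; rewrite fineK //; exact: integrable_fin_num.
Qed.

Lemma cvg_sint x (F : nat -> R -> R) f (M : R) : (forall n, bmeas (F n)) ->
    (forall n t, `|F n t| <= M) -> bmeas f ->
    (forall t, F n t @[n --> \oo] --> f t) ->
  sint x (F n) @[n --> \oo] --> sint x f.
Proof.
move=> bF FM bf Ff.
have [] // := @cvg_Rintegral_dominated x F f (cst M) _ _ Ff _ FM.
- by move=> n; have [] := bF n.
- by have [] := bf.
- by apply: bmeas_integrable; exact: bmeas_cst.
Qed.

End spectral_integrals.

(** * The bounded Borel functional calculus *)

Section bounded_functional_calculus.
Context {R : realType} {k : scalar_kind} {H : hilbert R k}.
Variable E : spectral_family H.
Implicit Types (x y z : H) (f g : R -> R) (l : R) (L : (R -> R) -> R).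

(** These functionals behave as integrals against finite signed measures, and are determined by
    their values on rays. *)
Definition bcontinuous L :=
  (forall c f g, bmeas f -> bmeas g -> L (fun t => c * f t + g t) = c * L f + L g) /\
  (forall (F : nat -> R -> R) f (M : R), (forall n, bmeas (F n)) ->
    (forall n t, `|F n t| <= M) -> bmeas f ->
    (forall t, F n t @[n --> \oo] --> f t) -> L (F n) @[n --> \oo] --> L f).

Lemma bcontinuous_sint x : bcontinuous (sint E x).
Proof.
split => [c f g bf bg|]; last exact: cvg_sint.
by rewrite sintD ?sintZ //; exact: bmeasZ.
Qed.

Lemma bcontinuousD L L' : bcontinuous L -> bcontinuous L' ->
  bcontinuous (fun f => L f + L' f).
Proof.
move=> [Ll Lc] [L'l L'c]; split => [c f g bf bg|F f M bF FM bf Ff].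
  by rewrite Ll // L'l //; ring.
by apply: cvgD; [exact: Lc Ff|exact: L'c Ff].
Qed.

Lemma bcontinuousZ c L : bcontinuous L -> bcontinuous (fun f => c * L f).
Proof.
move=> [Ll Lc]; split => [d f g bf bg|F f M bF FM bf Ff].
  by rewrite Ll //; ring.
by apply: cvgMr; exact: Lc Ff.
Qed.

Lemma bcontinuousM g L : bmeas g -> bcontinuous L ->
  bcontinuous (fun f => L (f \* g)).
Proof.
move=> bg [Ll Lc]; split => [c f h bf bh|F f M bF FM bf Ff].
  rewrite -Ll; [|exact: bmeasM..].
  by congr L; apply/funext => t /=; ring.
have [mg [N gN]] := bg.
apply: (Lc _ _ (M * N)) => //; [by move=> n; exact: bmeasM| |exact: bmeasM|].
  by move=> n t /=; rewrite normrM ler_pM.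
by move=> t; apply: cvgMl; exact: Ff.
Qed.

(** By the monotone class theorem. Most identities below are proved through it: both sides are such
    functionals of f, and on rays they reduce to the algebra of the projections [E l]. *)
Lemma bcontinuous_ext L L' : bcontinuous L -> bcontinuous L' ->
  (forall l, L \1_`]-oo, l] = L' \1_`]-oo, l]) -> forall f, bmeas f -> L f = L' f.
Proof.
move=> [Ll Lc] [L'l L'c] LL'; apply: bmeas_monotone_class => //.
  by move=> c f g bf bg Lf Lg; rewrite Ll // L'l // Lf Lg.
move=> F f M bF FM bf Ff LF; apply: (@cvg_unique _ _ (L (F n) @[n --> \oo])) => //.
  exact: Lc Ff.
rewrite (_ : (fun n => L (F n)) = (fun n => L' (F n))); first exact: L'c Ff.
exact/funext.
Qed.

Lemma bmeas_ray l : bmeas (\1_`]-oo, l] : R -> R).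
Proof. by apply: bmeas_indic; exact: measurable_itv. Qed.

Lemma rdot_sf l x y : rdot (E l x) y = rdot x (E l y).
Proof. by rewrite /rdot sf_sym. Qed.

(** Polarization: the integral of f against the signed measure with distribution function l |-> Re
    <E_l x, y>, see [sform_ray]. *)
Definition sform x y f := 4^-1 * (sint E (x + y) f - sint E (x - y) f).

Lemma bcontinuous_sform x y : bcontinuous (sform x y).
Proof.
apply: bcontinuousZ; apply: bcontinuousD; first exact: bcontinuous_sint.
under eq_fun do rewrite -mulN1r.
by apply: bcontinuousZ; exact: bcontinuous_sint.
Qed.

Lemma sform_ray x y l : sform x y \1_`]-oo, l] = rdot (E l x) y.
Proof.
rewrite /sform !sint_ray !hnorm_rdot linearB linearD /=.
have -> : rdot (E l x) y = rdot (E l x) (E l y) by rewrite -rdot_sf sf_mul minxx.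
rewrite !(rdotDl, rdotDr, rdotNl, rdotNr) (rdotC (E l y) (E l x)); lra.
Qed.

Lemma sformC x y f : bmeas f -> sform x y f = sform y x f.
Proof.
move: f; apply: bcontinuous_ext => [||l]; [exact: bcontinuous_sform..|].
by rewrite !sform_ray rdot_sf rdotC.
Qed.

Lemma sform_diag x f : bmeas f -> sform x x f = sint E x f.
Proof.
move: f; apply: bcontinuous_ext => [||l]; [exact: bcontinuous_sform|exact: bcontinuous_sint|].
by rewrite sform_ray sint_ray hnorm_rdot -rdot_sf sf_mul minxx.
Qed.

Lemma sint_parallelogram x y f : bmeas f ->
  sint E (x + y) f + sint E (x - y) f = 2 * (sint E x f + sint E y f).
Proof.
move: f; apply: bcontinuous_ext => [||l].
- by apply: bcontinuousD; exact: bcontinuous_sint.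
- by apply: bcontinuousZ; apply: bcontinuousD; exact: bcontinuous_sint.
rewrite !sint_ray !hnorm_rdot linearB linearD /=.
rewrite !(rdotDl, rdotDr, rdotNl, rdotNr); lra.
Qed.

(** On a ray ]-oo, m] the claim is E_m E_l = E_min(m, l). *)
Lemma sform_sf x y l f : bmeas f -> sform x (E l y) f = sform x y (f \* \1_`]-oo, l]).
Proof.
move: f; apply: bcontinuous_ext => [||m]; first exact: bcontinuous_sform.
  by apply: bcontinuousM; [exact: bmeas_ray|exact: bcontinuous_sform].
have -> : \1_`]-oo, m] \* \1_`]-oo, l] = \1_`]-oo, Num.min m l] :> (R -> R).
  apply/funext => t /=; rewrite !indicE !mem_setE !in_itv /= le_min.
  by case: (t <= m); case: (t <= l); rewrite ?mulr0 ?mul0r ?mulr1.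
by rewrite !sform_ray !rdot_sf sf_mul.
Qed.

(* [z = (\int f dE) x], tested on real parts, which determine [z]. *)
Definition sact f x z := forall y, rdot z y = sform x y f.

Lemma sact_ray l x : sact \1_`]-oo, l] x (E l x).
Proof. by move=> y; rewrite sform_ray. Qed.

Lemma sact_lin c f g x z z' : bmeas f -> bmeas g -> sact f x z -> sact g x z' ->
  sact (fun t => c * f t + g t) x (sreal c *: z + z').
Proof.
move=> bf bg fz gz' y.
by rewrite (bcontinuous_sform x y).1 // rdotDl rdotZl fz gz'.
Qed.

Lemma sactB f g x z z' : bmeas f -> bmeas g -> sact f x z -> sact g x z' ->
  sact (f \- g) x (z - z').
Proof.
move=> bf bg fz gz' y.
rewrite (_ : f \- g = (fun t => -1 * g t + f t)); last first.
  by apply/funext => t /=; rewrite mulN1r addrC.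
by rewrite -(sact_lin (-1) bg bf gz' fz y) !rdotDl rdotZl rdotNl mulN1r addrC.
Qed.

(** Tested on rays: <E_l z, y> = <z, E_l y> is the integral of g against <E x, E_l y>, which
    [sform_sf] cuts at l. *)
Lemma sact_sform f g x y z : bmeas f -> bmeas g -> sact g x z ->
  sform z y f = sform x y (f \* g).
Proof.
move=> bf bg gz; move: f bf; apply: bcontinuous_ext => [||l]; first exact: bcontinuous_sform.
  by apply: bcontinuousM => //; exact: bcontinuous_sform.
rewrite sform_ray rdot_sf gz sform_sf //; congr sform.
by apply/funext => t /=; rewrite mulrC.
Qed.

Lemma sact_rdot f g x z z' : bmeas f -> bmeas g -> sact f x z -> sact g x z' ->
  rdot z z' = sint E x (f \* g).
Proof.
move=> bf bg fz gz'; rewrite fz sformC // (sact_sform _ bf bg gz') sform_diag //.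
exact: bmeasM.
Qed.

(** The spectral measure of z = (\int g dE) x has density g^2 with respect to that of x; apply
    [sact_sform] once in each argument. *)
Lemma sact_sint f g x z : bmeas f -> bmeas g -> sact g x z ->
  sint E z f = sint E x (f \* g \* g).
Proof.
move=> bf bg gz; rewrite -sform_diag // (sact_sform _ bf bg gz) sformC; last exact: bmeasM.
rewrite (sact_sform _ (bmeasM bf bg) bg gz) sform_diag //.
by apply: bmeasM => //; exact: bmeasM.
Qed.

(** This isometry turns L^2 estimates on integrands into estimates on vectors. *)
Lemma sact_hnorm f x z : bmeas f -> sact f x z -> hnorm z ^+ 2 = sint E x (f \* f).
Proof. by move=> bf fz; rewrite hnorm_rdot (sact_rdot bf bf fz fz). Qed.

Lemma sact1 x : sact (cst 1) x x.
Proof.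
have H1 y : sform x y (cst 1) = rdot x y.
  rewrite /sform !sint1 !hnorm_rdot.
  by rewrite !(rdotDl, rdotDr, rdotNl, rdotNr) (rdotC y); lra.
by move=> y; rewrite H1.
Qed.

Lemma sact_exists f x : bmeas f -> exists z, sact f x z.
Proof.
move: f; apply: bmeas_monotone_class.
- by move=> l; exists (E l x); exact: sact_ray.
- move=> c f g bf bg [z fz] [z' gz']; exists (sreal c *: z + z').
  exact: sact_lin.
move=> F f M bF FM bf Ff /choice[u Fu].
(* Isometry, then (p - q)^2 <= 2 (p^2 + q^2) with p = F n - f and q = F m - f. *)
have d2 n m : hnorm (u n - u m) ^+ 2 <=
    2 * (sint E x ((F n \- f) \* (F n \- f)) + sint E x ((F m \- f) \* (F m \- f))).
  have bd i : bmeas (F i \- f) by exact: bmeasB.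
  rewrite (sact_hnorm _ (sactB (bF n) (bF m) (Fu n) (Fu m))); last exact: bmeasB.
  rewrite -sintD; [|exact: bmeasM..].
  rewrite -sintZ; last by apply: bmeasD; exact: bmeasM.
  apply: le_sint => [||t /=]; first by apply: bmeasM; exact: bmeasB.
    by apply: bmeasZ; apply: bmeasD; exact: bmeasM.
  have := sqr_ge0 (F n t - f t + (F m t - f t)); lra.
have cvg0 : sint E x ((F n \- f) \* (F n \- f)) @[n --> \oo] --> (0 : R).
  have -> : 0 = sint E x (cst 0) by rewrite /sint Rintegral_cst // mul0r.
  (* The limit inherits the bound M, so that the squared differences are at most (2 M)^2, as bounded
     convergence requires. *)
  have f0 t : `|f t| <= M.
    have cf : `|F n t| @[n --> \oo] --> `|f t| by exact: cvg_norm.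
    rewrite -(cvg_lim _ cf) //; apply: limr_le; first exact: cvgP cf.
    exact: nearW.
  apply: (@cvg_sint _ _ _ _ _ _ _ ((M + M) * (M + M))).
  - by move=> n; apply: bmeasM; exact: bmeasB.
  - by move=> n t /=; rewrite normrM ler_pM // (le_trans (ler_normB _ _)) // lerD.
  - exact: bmeas_cst.
  - move=> t /=; rewrite -[X in _ --> X](mulr0 0).
    by apply: cvgM; rewrite -(subrr (f t)); apply: cvgB => //; exact: cvg_cst.
have [z uz] : exists z, hnorm (u n - z) @[n --> \oo] --> (0 : R).
  apply: hilbert_complete => e e0.
  (* Two integrals below e^2 / 4 make the bound in [d2] less than e^2. *)
  have e1 : 0 < e ^+ 2 / 4 by rewrite divr_gt0 ?exprn_gt0.
  have /cvgrPdistC_lt/(_ _ e1)[N _ hN] := cvg0.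
  exists ([set n | (N <= n)%N], [set n | (N <= n)%N]); first by split; exists N.
  move=> [m n] /= [Nm Nn]; rewrite -ltr_sqr ?nnegrE ?hnorm_ge0 ?(ltW e0) //.
  apply: le_lt_trans (d2 _ _) _.
  have := hN _ Nm; have := hN _ Nn; rewrite /= !subr0.
  by move=> /(le_lt_trans (ler_norm _)) a /(le_lt_trans (ler_norm _)) b; lra.
(* Both sides of the identity defining [u n] pass to the limit. *)
exists z => y; apply: (@cvg_unique _ _ (rdot (u n) y @[n --> \oo])) => //.
  exact: cvg_rdot.
rewrite (_ : (fun n => _) = (fun n => sform x y (F n))); last first.
  by apply/funext => n; exact: Fu.
exact: (bcontinuous_sform x y).2 bF FM bf Ff.
Qed.

End bounded_functional_calculus.

(** * Unbounded integrands and the domains of their spectral integrals *)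

Section unbounded_functional_calculus.
Context {R : realType} {k : scalar_kind} {H : hilbert R k}.
Variable E : spectral_family H.
Implicit Types (u x y z : H) (f g h : R -> R).

(** Large values become 0, not n, so that truncation is multiplication by an indicator; for f >= 0
    it is still increasing in n. *)
Definition trunc (n : nat) f : R -> R := fun t => f t * \1_[set t | `|f t| <= n%:R] t.

Lemma truncE n f t : trunc n f t = if `|f t| <= n%:R then f t else 0.
Proof.
rewrite /trunc indicE; case: ifPn => ft; first by rewrite mem_set ?mulr1.
by rewrite memNset ?mulr0 //; exact/negP.
Qed.

Lemma bmeas_trunc n f : measurable_fun [set: R] f -> bmeas (trunc n f).
Proof.
move=> mf; split.
  apply: measurable_funM => //; apply: measurable_indic.
  rewrite (_ : [set _ | _] = setT `&` (Num.norm \o f) @^-1` `]-oo, n%:R]); last first.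
    by apply/seteqP; split => t /=; rewrite in_itv /= => // -[].
  have mnf : measurable_fun setT (Num.norm \o f) by exact: measurableT_comp.
  by apply: mnf => //; exact: measurable_itv.
by exists n%:R => t; rewrite truncE; case: ifPn => // _; rewrite normr0.
Qed.

Lemma normr_trunc n f t : `|trunc n f t| <= `|f t|.
Proof. by rewrite truncE; case: ifPn => // _; rewrite normr0. Qed.

Lemma cvg_trunc f t : trunc n f t @[n --> \oo] --> f t.
Proof.
apply: cvg_near_cst; exists (Num.bound `|f t|) => // n /= fn; rewrite truncE ifT //.
by rewrite (le_trans (ltW (archi_boundP (normr_ge0 _)))) ?ler_nat.
Qed.

Lemma trunc_ge0 n f t : (forall s, 0 <= f s) -> 0 <= trunc n f t.
Proof. by move=> f0; rewrite truncE; case: ifP. Qed.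

Lemma nd_trunc f t m n : (forall s, 0 <= f s) -> (m <= n)%N -> trunc m f t <= trunc n f t.
Proof.
move=> f0 mn; rewrite !truncE; case: ifPn => fm; last by case: ifP.
by rewrite ifT // (le_trans fm) // ler_nat.
Qed.

Definition sintegrable x f := (spectral_measure E x).-integrable setT (EFin \o f).

Lemma cvg_sint_trunc x f : measurable_fun [set: R] f -> sintegrable x f ->
  sint E x (trunc n f) @[n --> \oo] --> sint E x f.
Proof.
move=> mf xf.
have [] // := @cvg_Rintegral_dominated _ _ _ E x (trunc ^~ f) f (Num.norm \o f).
- by move=> n; have [] := bmeas_trunc n mf.
- exact: cvg_trunc.
- exact: integrable_norm.
- by move=> n t; exact: normr_trunc.
Qed.

Lemma le_sint_trunc x f n : measurable_fun [set: R] f -> (forall t, 0 <= f t) ->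
  sintegrable x f -> sint E x (trunc n f) <= sint E x f.
Proof.
move=> mf f0 xf; apply: le_Rintegral => //.
  by apply: bmeas_integrable; exact: bmeas_trunc.
by move=> t _; rewrite truncE; case: ifP.
Qed.

(** Monotone convergence: the integral of f is the limit of those of its truncations, hence at most
    M. *)
Lemma sintegrable_trunc x f (M : R) : measurable_fun [set: R] f -> (forall t, 0 <= f t) ->
  (forall n, sint E x (trunc n f) <= M) -> sintegrable x f.
Proof.
move=> mf f0 fM; apply/integrableP; split; first exact/measurable_EFinP.
have mt n : measurable_fun [set: measurableTypeR R] (fun t => (trunc n f t)%:E).
  by apply/measurable_EFinP; have [] := bmeas_trunc n mf.
have cvgI := @cvg_monotone_convergence _ _ R (spectral_measure E x) setT measurableT
  (fun n t => (trunc n f t)%:E) mt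
  (fun n t _ => trunc_ge0 n t f0)
  (fun t _ m n mn => nd_trunc t f0 mn).
apply: (@le_lt_trans _ _ M%:E); last exact: ltry.
rewrite (_ : integral _ _ _ = (\int[spectral_measure E x]_t (limn (fun n => (trunc n f t)%:E)))%E).
  rewrite -(cvg_lim _ cvgI) //; apply: lime_le; first exact: cvgP cvgI.
  apply: nearW => n; have := fM n; rewrite -lee_fin /sint /Rintegral fineK //.
  by apply: integrable_fin_num => //; apply: bmeas_integrable; exact: bmeas_trunc.
apply: eq_integral => t _ /=; rewrite ger0_norm //; apply/esym/cvg_lim => //.
by apply/cvg_EFin; [exact: nearW|exact: cvg_trunc].
Qed.

(** The measure is finite and |f| <= 1 + f^2. *)
Lemma sintegrable_sqr x f : measurable_fun [set: R] f -> sintegrable x (fun t => f t ^+ 2) ->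
  sintegrable x f.
Proof.
move=> mf xf; apply: (@le_integrable _ _ _ (spectral_measure E x) _ measurableT _
  (EFin \o (fun t => 1 + f t ^+ 2))) => //.
- exact/measurable_EFinP.
- move=> t _ /=; rewrite lee_fin [X in _ <= X]ger0_norm ?addr_ge0 ?sqr_ge0 //.
  rewrite -(real_normK (num_real (f t))).
  have := sqr_ge0 (`|f t| - 1); have := normr_ge0 (f t); nra.
rewrite (_ : EFin \o _ = (EFin \o cst 1%R) \+ (EFin \o (fun t => f t ^+ 2)%R))%E.
  by apply: integrableD => //; apply: bmeas_integrable; exact: bmeas_cst.
by apply/funext => t /=; rewrite EFinD.
Qed.

(** The parallelogram identity bounds the truncated integrals for x + y and x - y together. These
    are the two vectors whose measures enter [sform]. *)
Lemma sintegrableD x y f : measurable_fun [set: R] f -> (forall t, 0 <= f t) ->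
  sintegrable x f -> sintegrable y f ->
  sintegrable (x + y) f /\ sintegrable (x - y) f.
Proof.
move=> mf f0 xf yf; pose M := 2 * (sint E x f + sint E y f).
have le n : sint E (x + y) (trunc n f) + sint E (x - y) (trunc n f) <= M.
  rewrite sint_parallelogram; last exact: bmeas_trunc.
  by rewrite ler_wpM2l // lerD // le_sint_trunc.
have ge z n : 0 <= sint E z (trunc n f) by apply: sint_ge0 => t; exact: trunc_ge0.
split; apply: (@sintegrable_trunc _ _ M) => // n; apply: le_trans (le n).
  by rewrite lerDl.
by rewrite lerDr.
Qed.

(** By [sact_sint] the measure of y is g^2 times that of x, so that integrating f^2 amounts to
    integrating the bounded (f g)^2. *)
Lemma sact_sintegrable f g x y : measurable_fun [set: R] f -> bmeas g -> bmeas (f \* g) ->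
  sact E g x y -> sintegrable y (fun t => f t ^+ 2).
Proof.
move=> mf bg bfg gy; have [mfg [M fgM]] := bfg.
have mf2 : measurable_fun [set: R] (fun t => f t ^+ 2) by exact: measurable_funX.
apply: (sintegrable_trunc (M := sint E x (cst (M ^+ 2))) mf2 (fun t => sqr_ge0 (f t))) => n.
have bt := bmeas_trunc n mf2.
rewrite (sact_sint bt bg gy); apply: le_sint => [||t].
- by apply: bmeasM => //; exact: bmeasM.
- exact: bmeas_cst.
apply: (@le_trans _ _ ((f t * g t) ^+ 2)); last first.
  by rewrite /= -real_normK ?num_real // lerXn2r ?nnegrE // (le_trans _ (fgM t)).
rewrite exprMn /= -mulrA -expr2 ler_wpM2r ?sqr_ge0 //.
by rewrite truncE; case: ifP => // _; exact: sqr_ge0.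
Qed.

(* Truncation and dominated convergence extend [sact_sform] to unbounded
   integrands. *)
Lemma sform_sact f g u x y : measurable_fun [set: R] f -> bmeas g -> bmeas (f \* g) ->
  sintegrable u (fun t => f t ^+ 2) -> sact E g x y ->
  sform E u y f = sform E x u (f \* g).
Proof.
move=> mf bg bfg uf gy; have [mfg [M fgM]] := bfg.
have mf2 : measurable_fun [set: R] (fun t => f t ^+ 2) by exact: measurable_funX.
have yf := sact_sintegrable mf bg bfg gy.
have [/sintegrable_sqr uyD /sintegrable_sqr uyB] := sintegrableD mf2 (fun t => sqr_ge0 (f t)) uf yf.
have c1 : sform E u y (trunc n f) @[n --> \oo] --> sform E u y f.
  by apply: cvgMr; apply: cvgB; apply: cvg_sint_trunc => //; [exact: uyD|exact: uyB].
have c2 : sform E x u (trunc n f \* g) @[n --> \oo] --> sform E x u (f \* g).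
  apply: ((bcontinuous_sform E x u).2 _ _ M _ _ bfg).
  - by move=> n; apply: bmeasM => //; exact: bmeas_trunc.
  - move=> n t; apply: le_trans (fgM t); rewrite /= (normrM (trunc n f t)) (normrM (f t) (g t)) ler_wpM2r //.
    exact: normr_trunc.
  - by move=> t; apply: cvgMl; exact: cvg_trunc.
have e n : sform E u y (trunc n f) = sform E x u (trunc n f \* g).
  rewrite sformC; last exact: bmeas_trunc.
  exact: sact_sform (bmeas_trunc n mf) bg gy.
rewrite (funext e) in c1; exact: (cvg_unique _ c1 c2).
Qed.

Lemma spectral_formE (D : set R) f x y : spectral_form E D f x y = sform E x y (f \_ D).
Proof.
rewrite /spectral_form /sform /sint.
by congr (_ * (_ - _)); exact: Rintegral_mkcond.
Qed.

(** Passes from integrals over D to integrals over the line of the extension by zero, for which the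
    calculus is developed. *)
Lemma spectral_domainP (D : set R) f x : measurable D ->
  spectral_domain E D f x <->
  measurable_fun [set: R] (f \_ D) /\ sintegrable x (fun t => (f \_ D) t ^+ 2).
Proof.
move=> mD.
have fE : EFin \o (fun t => (f \_ D) t ^+ 2) = (fun l => (f l ^+ 2)%:E) \_ D.
  by apply/funext => t; rewrite /= !patchE; case: ifP => //; rewrite expr0n.
have [h1 h2] := integrable_mkcond (mu := spectral_measure E x) (fun l => (f l ^+ 2)%:E) mD.
split => -[mf xf].
  split; first exact/(measurable_restrictT f mD).
  by rewrite /sintegrable fE; exact: h1.
split; first exact/(measurable_restrictT f mD).
by apply: h2; rewrite -fE.
Qed.

End unbounded_functional_calculus.

(** * The operator norm of a continuous linear map *)

Section operator_norm.
Context {R : realType} {k : scalar_kind} {X Y : hilbert R k}.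
Variable T : {linear X -> Y}.
Hypothesis cT : continuous T.

Lemma hnorm_sreal (V : hilbert R k) (c : R) (x : V) : hnorm (sreal c *: x) = `|c| * hnorm x.
Proof.
apply/eqP; rewrite -(@eqrXn2 _ 2) ?mulr_ge0 ?hnorm_ge0 //.
by rewrite exprMn !hnorm_rdot rdotZl rdotZr real_normK ?num_real // expr2 mulrA.
Qed.

(** Continuity bounds T on the unit ball, so that the [sup] in [opnorm] is a genuine supremum. *)
Lemma opnorm_has_ubound : has_ubound [set hnorm (T x) | x in [set x : X | hnorm x <= 1]].
Proof.
have /linear_bounded_continuous/bounded_funP/(_ 1)[M hM] := cT.
exists (sRe M) => _ [x /= x1 <-].
have sM (z w : scalars R k) : z <= w -> sRe z <= sRe w.
  by move=> zw; rewrite -[w](subrK z) sReD lerDr sRe_ge0 // subr_ge0.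
apply/sM/hM; have := normr_ge0 x; move: x1; rewrite /hnorm; move: `|x|; clear.
case: k => //= z z1; rewrite !lecE /= => /andP[/eqP -> _].
by rewrite eqxx.
Qed.

Lemma ler_opnorm x : hnorm (T x) <= opnorm T * hnorm x.
Proof.
have [x0|x0] := eqVneq (hnorm x) 0.
  by rewrite (hnorm0_eq0 x0) linear0 hnorm0 hnorm0 mulr0.
have xp : 0 < hnorm x by rewrite lt_neqAle eq_sym x0 hnorm_ge0.
have xi : `|(hnorm x)^-1| = (hnorm x)^-1 by rewrite ger0_norm // invr_ge0 ltW.
rewrite -ler_pdivrMr // mulrC -xi -hnorm_sreal -linearZ.
apply: (ub_le_sup opnorm_has_ubound).
exists (sreal (hnorm x)^-1 *: x) => //=.
by rewrite hnorm_sreal xi mulVf.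
Qed.

Lemma hnorm_sqr_opnorm x : hnorm (T x) ^+ 2 <= opnorm T ^+ 2 * hnorm x ^+ 2.
Proof.
have b0 : 0 <= opnorm T.
  rewrite -(hnorm0 (H := Y)) -(linear0 T); apply: (ub_le_sup opnorm_has_ubound).
  by exists 0 => //=; rewrite hnorm0.
by rewrite -exprMn lerXn2r ?nnegrE ?mulr_ge0 ?hnorm_ge0 // ler_opnorm.
Qed.

End operator_norm.

(** * Spectral measures of T^*T: localization on ]0, |T|^2] and the residual estimate *)

Section spectral_family_of_normal_operator.
Context {R : realType} {k : scalar_kind} {X Y : hilbert R k}.
Variables (T : {linear X -> Y}) (Tstar : {linear Y -> X}) (E : spectral_family X).
Hypothesis cT : continuous T.
Hypothesis injT : injective T.
Hypothesis adjT : is_adjoint T Tstar.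
Hypothesis ET : is_spectral_family_of E (fun v => Tstar (T v)).
Implicit Types (x y : X) (f g : R -> R).

Let b := opnorm T ^+ 2.

Lemma rdot_TstarT x y : rdot (Tstar (T x)) y = rdot (T x) (T y).
Proof. by rewrite rdotC /rdot -adjT -/(rdot _ _) rdotC. Qed.

Lemma sintegrable_sqr_id x : sintegrable E x (fun t => t ^+ 2).
Proof.
by have [/spectral_domainP[//|_]] := ET x; rewrite patch_setT.
Qed.

(** The integrand l |-> l is unbounded on R, whence [sform_sact]; u and y are in its domain because
    [ET] applies to every vector. *)
Lemma sact_TstarT g x y u : bmeas g -> bmeas (fun t => t * g t) -> sact E g x y ->
  rdot (Tstar (T u)) y = sform E x u (fun t => t * g t).
Proof.
move=> bg big gy; have [_ h] := ET u.
rewrite /rdot h; last by have [] := ET y.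
rewrite spectral_formE patch_setT.
have mid : measurable_fun [set: R] (fun t : R => t) by exact: measurable_id.
by rewrite (sform_sact mid bg _ (sintegrable_sqr_id u) gy).
Qed.

Lemma bmeas_id_indic (B : set R) (M : R) : measurable B -> (forall t, B t -> `|t| <= M) ->
  bmeas (fun t : R => t * \1_B t).
Proof.
move=> mB BM; split; first by apply: measurable_funM; [exact: measurable_id|exact: measurable_indic].
exists `|M| => t; rewrite indicE; have [/set_mem/BM tM|_] := boolP (t \in B).
  by rewrite mulr1 (le_trans tM) // ler_norm.
by rewrite mulr0 normr0.
Qed.

(** As 1_B^2 = 1_B, the first moment of B is <T^*T y, y> and its mass is <y, y>. Bounds on t over B
    thus compare |T y| with |y|. *)
Lemma sint_indic_id x y (B : set R) (M : R) : measurable B -> (forall t, B t -> `|t| <= M) ->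
  sact E \1_B x y ->
  sint E x (fun t => t * \1_B t) = hnorm (T y) ^+ 2 /\ sint E x \1_B = hnorm y ^+ 2.
Proof.
move=> mB BM By; have bB := bmeas_indic mB; have bidB := bmeas_id_indic mB BM.
have BB : \1_B \* \1_B = \1_B :> (R -> R).
  by apply/funext => t /=; rewrite indicE; case: (_ \in _); rewrite ?mulr1 ?mulr0.
split; last by rewrite (sact_hnorm bB By) BB.
rewrite hnorm_rdot -rdot_TstarT (sact_TstarT _ bB bidB By) sformC //.
rewrite (sact_sform _ bidB bB By) sform_diag; last exact: bmeasM.
by congr sint; apply/funext => t /=; rewrite -mulrA -[X in _ = _ * X]/((\1_B \* \1_B) t) BB.
Qed.

(* For [y = 1_F(T^*T) x] with [F] in ]-oo, 0], |T y|^2 = \int_F t <= 0, so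
   that y = 0 by injectivity; in particular 0 carries no mass. *)
Lemma sint_indic_npos x : sint E x \1_`]-oo, 0] = 0.
Proof.
(* Bounded pieces of the ray, as [sint_indic_id] requires. *)
pose F n : set R := `[- n%:R, 0]%classic.
have mF n : measurable (F n) by exact: measurable_itv.
have F0 n : sint E x \1_(F n) = 0.
  have bF := bmeas_indic (mF n).
  have FM t : F n t -> `|t| <= n%:R.
    by rewrite /F /= in_itv /= => /andP[nt t0]; rewrite ler0_norm // lerNl.
  have [y Fy] := sact_exists E x bF.
  have [idF ->] := sint_indic_id (mF n) FM Fy.
  suff -> : y = 0 by rewrite hnorm0 expr0n.
  apply: injT; rewrite linear0; apply: hnorm0_eq0; apply/eqP.
  rewrite -sqrf_eq0 eq_le sqr_ge0 andbT -idF.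
  rewrite -[leRHS](mul0r (sint E x \1_(F n))) -sintZ //; apply: le_sint => [||t].
  - exact: bmeas_id_indic FM.
  - exact: bmeasZ.
  - rewrite indicE; have [/set_mem|_] := boolP (t \in F n); last by rewrite !mulr0.
    by rewrite /F /= in_itv /= => /andP[_ t0]; rewrite mul0r mulr1.
have FE : `]-oo, 0%R]%classic = \bigcup_n F n.
  apply/seteqP; split => [t /=|t [n _]]; rewrite /F /= !in_itv /=; last by case/andP.
  move=> t0; exists (Num.bound `|t|) => //=; rewrite in_itv /= t0 andbT lerNl.
  by rewrite (le_trans (ler_norm _)) // normrN ltW // archi_boundP.
have c1 : sint E x \1_(F n) @[n --> \oo] --> sint E x \1_(\bigcup_n F n).
  apply: (@cvg_sint _ _ _ _ _ _ _ 1) => //.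
  - by move=> n; exact: bmeas_indic.
  - by move=> n t; rewrite indicE; case: (_ \in _); rewrite ?normr1 ?normr0.
  - by apply: bmeas_indic; exact: bigcupT_measurable.
  - move=> t; apply: cvg_indic_bigcup => m n mn; apply/subsetPset/subset_itv => //.
    by rewrite leBSide /= lerN2 ler_nat.
by rewrite (funext F0) in c1; rewrite FE; exact: (cvg_unique _ c1 (cvg_cst _)).
Qed.

(** For y = 1_F(T^*T) x with F = [b + 1/(n+1), n], the inequalities (b + 1/(n+1)) |y|^2 <= |T y|^2
    <= b |y|^2 force y = 0; such F exhaust ]b, +oo[. *)
Lemma sint_indic_gt x : sint E x \1_`]b, +oo[ = 0.
Proof.
pose F n : set R := `[b + n.+1%:R^-1, n%:R]%classic.
have mF n : measurable (F n) by exact: measurable_itv.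
have b0 : 0 <= b by exact: sqr_ge0.
have F0 n : sint E x \1_(F n) = 0.
  have bF := bmeas_indic (mF n).
  have FM t : F n t -> `|t| <= n%:R.
    rewrite /F /= in_itv /= => /andP[nt tn]; rewrite ger0_norm // (le_trans _ nt) //.
    by rewrite addr_ge0.
  have [y Fy] := sact_exists E x bF.
  have [idF yF] := sint_indic_id (mF n) FM Fy.
  have le1 : sint E x (fun t => t * \1_(F n) t) <= b * sint E x \1_(F n).
    by rewrite idF yF; exact: hnorm_sqr_opnorm.
  have le2 : (b + n.+1%:R^-1) * sint E x \1_(F n) <= sint E x (fun t => t * \1_(F n) t).
    rewrite -sintZ //; apply: le_sint => [||t].
    - exact: bmeasZ.
    - exact: bmeas_id_indic FM.
    - rewrite indicE; have [/set_mem|_] := boolP (t \in F n); last by rewrite !mulr0.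
      by rewrite /F /= in_itv /= => /andP[? _]; rewrite !mulr1.
  apply/eqP; rewrite eq_le {2}yF sqr_ge0 andbT.
  have := le_trans le2 le1; rewrite mulrDl gerDl.
  by rewrite pmulr_rle0 // invr_gt0.
have FE : `]b, +oo[%classic = \bigcup_n F n.
  apply/seteqP; split => [t /=|t [n _]]; rewrite /F /= !in_itv /= ?andbT; last first.
    by case/andP => + _; apply: lt_le_trans; rewrite ltrDl invr_gt0.
  (* n must be at least t, and at least 1/(t - b) so that b + 1/(n+1) <= t. *)
  move=> bt; pose n := maxn (Num.bound `|t|) (Num.bound (t - b)^-1).
  have tb : 0 <= (t - b)^-1 by rewrite invr_ge0 subr_ge0 ltW.
  exists n => //=; rewrite in_itv /=; apply/andP; split; last first.
    rewrite (le_trans (ler_norm _)) // (le_trans (ltW (archi_boundP (normr_ge0 t)))) //.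
    by rewrite ler_nat leq_maxl.
  rewrite -lerBrDl -[leRHS]invrK lef_pV2 ?posrE ?invr_gt0 ?subr_gt0 //.
  rewrite (le_trans (ltW (archi_boundP tb))) // ler_nat.
  by rewrite leqW // leq_maxr.
have c1 : sint E x \1_(F n) @[n --> \oo] --> sint E x \1_(\bigcup_n F n).
  apply: (@cvg_sint _ _ _ _ _ _ _ 1) => //.
  - by move=> n; exact: bmeas_indic.
  - by move=> n t; rewrite indicE; case: (_ \in _); rewrite ?normr1 ?normr0.
  - by apply: bmeas_indic; exact: bigcupT_measurable.
  - move=> t; apply: cvg_indic_bigcup => m n mn; apply/subsetPset/subset_itv => //.
      by rewrite leBSide /= lerD2l lef_pV2 ?posrE // ler_nat.
    by rewrite leBSide /= ler_nat.
by rewrite (funext F0) in c1; rewrite FE; exact: (cvg_unique _ c1 (cvg_cst _)).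
Qed.

(** The complement of ]0, b] is null by the two preceding lemmas, and M times its indicator
    dominates |f|. *)
Lemma sint_eq0 x f : bmeas f -> (forall t, t \in `]0, b] -> f t = 0) -> sint E x f = 0.
Proof.
move=> bf f0; have [_ [M fM]] := bf.
have bN : bmeas (\1_`]-oo, 0] : R -> R) by exact: bmeas_ray.
have bP : bmeas (\1_`]b, +oo[ : R -> R) by apply: bmeas_indic; exact: measurable_itv.
have bNP c : bmeas (fun t => c * (\1_`]-oo, 0] t + \1_`]b, +oo[ t)).
  by apply: bmeasZ; exact: bmeasD.
have NP0 c : sint E x (fun t => c * (\1_`]-oo, 0] t + \1_`]b, +oo[ t)) = 0.
  by rewrite sintZ ?sintD ?sint_indic_npos ?sint_indic_gt ?addr0 ?mulr0 //; exact: bmeasD.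
have h t : `|f t| <= M * (\1_`]-oo, 0] t + \1_`]b, +oo[ t).
  have M0 : 0 <= M by exact: le_trans (fM 0).
  have [tb|tb] := boolP (t \in `]0, b]).
    by rewrite f0 // normr0 mulr_ge0 // addr_ge0 // indicE.
  apply: (le_trans (fM t)); rewrite ler_peMr //.
  move: tb; rewrite !indicE !mem_setE !in_itv /= andbT negb_and -leNgt -ltNge.
  by move=> /orP[->|->]; rewrite ?lerDl ?lerDr ler0n.
have lh t : - M * (\1_`]-oo, 0] t + \1_`]b, +oo[ t) <= f t <=
    M * (\1_`]-oo, 0] t + \1_`]b, +oo[ t).
  by rewrite mulNr -ler_norml.
apply/eqP; rewrite eq_le; apply/andP; split.
  by rewrite -[leRHS](NP0 M); apply: le_sint => // t; have /andP[] := lh t.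
by rewrite -[leLHS](NP0 (- M)); apply: le_sint => // t; have /andP[] := lh t.
Qed.

Lemma eq_sint x f g : bmeas f -> bmeas g -> (forall t, t \in `]0, b] -> f t = g t) ->
  sint E x f = sint E x g.
Proof.
move=> bf bg fg; apply/eqP; rewrite -subr_eq0 -sintB //; apply/eqP.
apply: sint_eq0; first exact: bmeasB.
by move=> t tb; rewrite fg // subrr.
Qed.

Lemma eq_sform x y f g : bmeas f -> bmeas g -> (forall t, t \in `]0, b] -> f t = g t) ->
  sform E x y f = sform E x y g.
Proof. by move=> bf bg fg; rewrite /sform !(eq_sint _ bf bg fg). Qed.

(* With [h = residual * 1_[c, b]] and [y = h(T^*T) x], one has
   <v - x, y> = - \int h^2 = - |y|^2; conclude by Cauchy-Schwarz. *)
Lemma sint_residual_sqr_le (ga : R -> R) x v (c C : R) :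
  0 < c -> (forall t, t \in `[0, b] -> `|t * ga t| <= C) ->
  spectral_integral E `[0, b] ga (Tstar (T x)) v ->
  sint E x (fun t => (1 - t * ga t) ^+ 2 * \1_`[c, b] t) <= hnorm (v - x) ^+ 2 /\
  bmeas (fun t => (1 - t * ga t) ^+ 2 * \1_`[c, b] t).
Proof.
move=> c0 gC [dA vE].
pose G := ga \_ `[0, b].
have m0b : measurable (`[0, b]%classic : set R) by exact: measurable_itv.
have /(spectral_domainP _ _ _ m0b)[mG AG] := dA.
have Gc t : t \in `[c, b] -> G t = ga t.
  rewrite in_itv /= => /andP[ct tb]; rewrite /G patchE ifT // mem_set //=.
  by rewrite in_itv /= tb (le_trans (ltW c0)).
pose h : R -> R := fun t => (1 - t * G t) * \1_`[c, b] t.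
have c0b t : t \in `[c, b] -> t \in `[0, b].
  by rewrite !in_itv /= => /andP[ct ->]; rewrite (le_trans (ltW c0)).
have bh : bmeas h.
  split.
    apply: measurable_funM; last exact: measurable_indic.
    apply: measurable_funB; first exact: measurable_cst.
    by apply: measurable_funM => //; exact: measurable_id.
  exists (1 + `|C|) => t; rewrite /h indicE mem_setE.
  have [tb|_] := boolP (t \in `[c, b]); last by rewrite mulr0 normr0 addr_ge0.
  rewrite mulr1 (le_trans (ler_normB _ _)) // normr1 lerD2l Gc //.
  by rewrite (le_trans (gC _ (c0b _ tb))) // ler_norm.
(* On [c, b], |t ga(t)| <= C and t >= c give |ga(t)| <= C / c: this is what the cut-off at c > 0
   achieves. *)
have bG : bmeas (fun t => G t * \1_`[c, b] t).
  split; first by apply: measurable_funM => //; exact: measurable_indic.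
  exists (`|C| / c) => t; rewrite indicE mem_setE.
  have [tb|_] := boolP (t \in `[c, b]); last first.
    by rewrite mulr0 normr0 divr_ge0 // ltW.
  rewrite mulr1 ler_pdivlMr // Gc //.
  apply: (@le_trans _ _ `|t * ga t|).
    rewrite normrM mulrC ler_wpM2r // ger0_norm.
      by move: tb; rewrite in_itv /= => /andP[].
    by move: (c0b _ tb); rewrite in_itv /= => /andP[].
  by rewrite (le_trans (gC _ (c0b _ tb))) // ler_norm.
have II t : \1_`[c, b] t * \1_`[c, b] t = \1_`[c, b] t :> R.
  by rewrite indicE; case: (_ \in _); rewrite ?mulr1 ?mulr0.
(* The cut-off in h is idempotent, so a second copy of it replaces G by its bounded restriction to
   [c, b]. *)
have GhE : G \* h = (fun t => G t * \1_`[c, b] t) \* h.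
  by apply/funext => t /=; rewrite /h -[in LHS]II; ring.
have bGh : bmeas (G \* h) by rewrite GhE; exact: bmeasM.
have biGh : bmeas (fun t => t * (G \* h) t).
  rewrite (_ : (fun t => _) = (fun t => t * \1_`[c, b] t) \* (G \* h)); last first.
    by apply/funext => t /=; rewrite /h -[in LHS]II; ring.
  apply: bmeasM => //; apply: (@bmeas_id_indic _ b); first exact: measurable_itv.
  move=> t /= tb; rewrite ger0_norm.
    by move: tb; rewrite in_itv /= => /andP[].
  by move: (c0b _ tb); rewrite in_itv /= => /andP[].
have [y hy] := sact_exists E x bh.
have [y' Ghy'] := sact_exists E x bGh.
(* y lies in the domain of ga(T^*T), as G h is bounded; so v may be tested against it. *)
have dy : spectral_domain E `[0, b] ga y.
  by apply/spectral_domainP => //; split => //; exact: sact_sintegrable hy.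
(* Moving ga(T^*T) from T^*T x onto y gives <v, y> = <T^*T x, y'> with y' = (G h)(T^*T) x. *)
have vy : rdot v y = sint E x (fun t => t * (G \* h) t).
  rewrite {1}/rdot vE // spectral_formE (sform_sact mG bh bGh AG hy) -Ghy' rdotC.
  by rewrite (sact_TstarT _ bGh biGh Ghy') sform_diag.
have xy : rdot x y = sint E x h.
  have b1 : bmeas (cst 1 : R -> R) by exact: bmeas_cst.
  rewrite (sact_rdot b1 bh (sact1 E x) hy).
  by congr sint; apply/funext => t /=; rewrite mul1r.
have vxy : rdot (v - x) y = - hnorm y ^+ 2.
  rewrite rdotBl vy xy -sintB // (sact_hnorm bh hy).
  rewrite -mulN1r -sintZ; last exact: bmeasM.
  congr sint; apply/funext => t /=; rewrite /h.
  transitivity (- 1 * ((1 - t * G t) ^+ 2 * (\1_`[c, b] t * \1_`[c, b] t))); last ring.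
  by rewrite II; ring.
have hhE : (fun t => (1 - t * ga t) ^+ 2 * \1_`[c, b] t) = h \* h.
  apply/funext => t; rewrite /h /= indicE mem_setE.
  by have [tb|_] := boolP (t \in `[c, b]); rewrite ?mulr0 ?mul0r // !mulr1 Gc // expr2.
rewrite hhE; split; last exact: bmeasM.
rewrite -(sact_hnorm bh hy).
have := rdot_le (v - x) y; rewrite vxy normrN ger0_norm ?sqr_ge0 //.
have [->|y0] := eqVneq (hnorm y) 0; first by rewrite expr0n /= sqr_ge0.
have yp : 0 < hnorm y by rewrite lt_neqAle eq_sym y0 hnorm_ge0.
rewrite expr2 ler_pM2r // => yv.
by rewrite expr2 ler_pM // hnorm_ge0.
Qed.

End spectral_family_of_normal_operator.

(** * Truncations of 1/rho away from 0 *)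

Section truncated_inverse.
Context {R : realType}.
Variables (b : R) (rho : R -> R).
Hypothesis b_gt0 : 0 < b.
Hypothesis rho_gt0 : {in `]0, b], forall t, 0 < rho t}.
Hypothesis rho_le : {in `]0, b] &, {homo rho : t u / t <= u}}.
Hypothesis mrho : measurable_fun (`]0, b] : set R) rho.

(** The cut-off at 1/(n+1) keeps 1/rho bounded, which it need not be near 0. *)
Definition inv_trunc (n : nat) : R -> R :=
  fun t => (rho t)^-1 * \1_`]n.+1%:R^-1, b] t.

Lemma inv_truncE n t : inv_trunc n t = if t \in `]n.+1%:R^-1, b] then (rho t)^-1 else 0.
Proof. by rewrite /inv_trunc indicE mem_setE; case: ifP; rewrite ?mulr1 ?mulr0. Qed.

Lemma itv_inv_trunc n t : t \in `]n.+1%:R^-1, b] -> t \in `]0, b].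
Proof.
by rewrite !in_itv /= => /andP[nt ->]; rewrite (lt_trans _ nt) // invr_gt0.
Qed.

Let rho_ge0 t : t \in `]0, b] -> 0 <= rho t.
Proof. by move=> tb; rewrite ltW // rho_gt0. Qed.

Lemma bmeas_rho : bmeas (rho \_ `]0, b]).
Proof.
split; first by apply/(measurable_restrictT rho) => //; exact: measurable_itv.
exists (rho b) => t; rewrite patchE mem_setE.
have bb : b \in `]0, b] by rewrite in_itv /= b_gt0 lexx.
have [tb|_] := boolP (t \in `]0, b]); last by rewrite normr0 rho_ge0.
rewrite ger0_norm ?rho_ge0 // rho_le //.
by move: tb; rewrite in_itv /= => /andP[].
Qed.

Lemma bmeas_inv_trunc n : bmeas (inv_trunc n).
Proof.
have mP := bmeas_measurable bmeas_rho.
(* On the cut-off interval 1/rho is the power -1 of the extension by zero of rho, which is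
   measurable on the whole line. *)
have -> : inv_trunc n = (fun t => ((rho \_ `]0, b]) t) `^ (-1) * \1_`]n.+1%:R^-1, b] t).
  apply/funext => t; rewrite inv_truncE indicE mem_setE.
  have [tb|_] := boolP (t \in `]n.+1%:R^-1, b]); rewrite ?mulr1 ?mulr0 //.
  have t0 := itv_inv_trunc tb.
  by rewrite patchE mem_setE t0 powR_inv1 // ltW // rho_gt0.
split.
  apply: measurable_funM; last exact: measurable_indic.
  apply: (@measurableT_comp _ _ _ _ _ _ (fun u : R => u `^ (-1)) _ (rho \_ `]0, b])) => //.
(* As rho is nondecreasing, 1/rho is at most its value at 1/(n+1), a point of ]0, b] as soon as the
   interval contains some t. *)
exists `|(rho n.+1%:R^-1)^-1| => t; rewrite indicE mem_setE.
have [tb|_] := boolP (t \in `]n.+1%:R^-1, b]); rewrite ?mulr1 ?mulr0 ?normr0 //.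
have t0 := itv_inv_trunc tb.
have n0 : (n.+1%:R^-1 : R) \in `]0, b].
  move: tb; rewrite !in_itv /= invr_gt0 => /andP[nt tb].
  by rewrite ltr0Sn (le_trans (ltW nt)).
rewrite patchE mem_setE t0 powR_inv1 ?rho_ge0 //.
rewrite !normfV !ger0_norm ?rho_ge0 // lef_pV2 ?posrE ?rho_gt0 // rho_le //.
by move: tb; rewrite in_itv /= => /andP[/ltW].
Qed.

(** Gives (phi_n - phi_m)^2 = phi_n^2 - phi_m^2 for the truncations phi_n, so that squared distances
    become increments. *)
Lemma inv_truncM m n t : (m <= n)%N -> inv_trunc m t * inv_trunc n t = inv_trunc m t ^+ 2.
Proof.
move=> mn; rewrite !inv_truncE.
have [tm|_] := boolP (t \in `]m.+1%:R^-1, b]); last by rewrite mul0r expr0n.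
rewrite ifT ?expr2 //; move: tm; rewrite !in_itv /= => /andP[mt ->]; rewrite andbT.
by apply: le_lt_trans mt; rewrite lef_pV2 ?posrE // ler_nat.
Qed.

End truncated_inverse.

(** * Solving rho(T^*T) w = x from a uniform bound on the truncated integrals of rho^-2 *)

Section inverse_spectral_integral.
Context {R : realType} {k : scalar_kind} {X Y : hilbert R k}.
Variables (T : {linear X -> Y}) (Tstar : {linear Y -> X}) (E : spectral_family X).
Hypothesis cT : continuous T.
Hypothesis injT : injective T.
Hypothesis adjT : is_adjoint T Tstar.
Hypothesis ET : is_spectral_family_of E (fun v => Tstar (T v)).

Let b := opnorm T ^+ 2.

Lemma spectral_integral_preimage (rho : R -> R) x (K : R) :
  0 < b -> {in `]0, b], forall t, 0 < rho t} ->
  {in `]0, b] &, {homo rho : t u / t <= u}} ->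
  measurable_fun (`]0, b] : set R) rho ->
  (forall n, sint E x (inv_trunc b rho n \* inv_trunc b rho n) <= K) ->
  exists w, spectral_integral E `]0, b] rho w x.
Proof.
move=> b_gt0 rho_gt0 rho_le mrho; set invt := inv_trunc b rho => IK.
have bphi n : bmeas (invt n) by exact: bmeas_inv_trunc.
pose I n := sint E x (invt n \* invt n).
have bI n : bmeas (invt n \* invt n).
  by apply: bmeasM.
have /choice[z zE] : forall n, exists z, sact E (invt n) x z.
  by move=> n; apply: sact_exists.
(* By isometry and [inv_truncM], |z n - z m|^2 is an increment of the sequence I, which is monotone
   and bounded by K; hence z is Cauchy. *)
have dz m n : (m <= n)%N -> hnorm (z n - z m) ^+ 2 = I n - I m.
  move=> mn; have bmn := bmeasB (bphi n) (bphi m).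
  rewrite (sact_hnorm bmn (sactB (bphi n) (bphi m) (zE n) (zE m))).
  rewrite /I -sintB //; congr sint; apply/funext => t /=.
  by have : invt m t * invt n t = invt m t ^+ 2 := inv_truncM b rho t mn; lra.
have ndI : nondecreasing_seq I.
  by move=> m n mn; rewrite -subr_ge0 -dz // sqr_ge0.
have cI : cvgn I by apply: nondecreasing_is_cvgn => //; exists K => _ [n _ <-]; exact: IK.
have [w zw] : exists w, hnorm (z n - w) @[n --> \oo] --> (0 : R).
  apply: hilbert_complete => e e0.
  have e2 : 0 < (e / 2) ^+ 2 by rewrite exprn_gt0 // divr_gt0.
  have /cvgrPdist_lt/(_ _ e2)[N _ hN] := cI.
  have zN n : (N <= n)%N -> hnorm (z n - z N) < e / 2.
    move=> Nn; rewrite -ltr_sqr ?nnegrE ?hnorm_ge0 ?divr_ge0 ?(ltW e0) // dz //.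
    have := hN _ (leqnn N); rewrite /= => /(le_lt_trans (ler_norm _)).
    by apply: le_lt_trans; rewrite lerD2r; exact: nondecreasing_cvgn_le.
  exists ([set n | (N <= n)%N], [set n | (N <= n)%N]); first by split; exists N.
  move=> [m n] /= [Nm Nn]; have := zN _ Nm; have := zN _ Nn.
  have -> : z m - z n = (z m - z N) + (z N - z n) by rewrite addrA subrK.
  move=> zn zm; apply: le_lt_trans (ler_hnormD _ _) _.
  by rewrite -(hnorm_opp (z N - z n)) opprB; lra.
have bP := bmeas_rho b_gt0 rho_gt0 rho_le mrho; have m0b : measurable (`]0, b]%classic : set R) by exact: measurable_itv.
(* w is in the domain like any vector, since rho extended by zero is bounded by rho(b). *)
exists w; split.
  apply/spectral_domainP => //; split; first exact: bmeas_measurable.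
  exact: (bmeas_integrable E w (bmeasM bP bP)).
move=> y _; rewrite spectral_formE.
(* For p = rho(T^*T) y, <rho(T^*T) w, y> = <w, p> = lim <z n, p>; rho times its truncated inverse is
   the indicator of ]1/(n+1), b]. *)
have [p yp] := sact_exists E y bP.
have c1 : rdot (z n) p @[n --> \oo] --> rdot w p by exact: cvg_rdot.
pose J n : R -> R := \1_`]n.+1%:R^-1, b].
have bJ n : bmeas (J n) by apply: bmeas_indic; exact: measurable_itv.
have b0b : bmeas (\1_`]0, b] : R -> R) by exact: bmeas_indic.
have zpE n : rdot (z n) p = sform E x y (J n).
  rewrite rdotC yp (sformC _ _ _ bP) (sact_sform _ bP (bphi n) (zE n)).
  congr sform; apply/funext => t; rewrite /= /invt inv_truncE /J indicE mem_setE.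
  have [tb|_] := boolP (t \in `]n.+1%:R^-1, b]); last by rewrite mulr0.
  by rewrite patchE mem_setE (itv_inv_trunc tb) divff // gt_eqF // rho_gt0 // (itv_inv_trunc tb).
have c2 : sform E x y (J n) @[n --> \oo] --> sform E x y \1_`]0, b].
  apply: ((bcontinuous_sform E x y).2 _ _ 1 bJ _ b0b) => [n t|t].
    by rewrite /J indicE; case: (_ \in _); rewrite ?normr1 ?normr0.
  have -> : `]0, b]%classic = \bigcup_n (`]n.+1%:R^-1, b]%classic : set R).
    apply/seteqP; split => [s /= sb|s [n _] /= sb]; last exact: itv_inv_trunc sb.
    move: sb; rewrite !in_itv /= => /andP[s0 sb].
    have si : 0 <= s^-1 by rewrite invr_ge0 ltW.
    exists (Num.bound s^-1) => //=; rewrite in_itv /= sb andbT.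
    rewrite -[ltRHS]invrK ltf_pV2 ?posrE ?invr_gt0 //.
    by rewrite (lt_le_trans (archi_boundP si)) // ler_nat.
  apply: cvg_indic_bigcup => m n mn; apply/subsetPset/subset_itv => //.
  by rewrite leBSide /= lef_pV2 ?posrE // ler_nat.
rewrite (funext zpE) in c1.
have -> : sform E w y (rho \_ `]0, b]) = rdot w p.
  by rewrite (sformC _ _ _ bP) -yp rdotC.
rewrite (cvg_unique (@Rhausdorff R) c1 c2).
(* The indicator of ]0, b] may be replaced by 1, since ]0, b] carries the spectral measures; in
   particular 0 has no mass, by injectivity of T. *)
transitivity (sform E x y (cst 1)); first exact: (sact1 E x y).
apply: (eq_sform cT injT adjT ET) => //; first exact: bmeas_cst.
by move=> t tb; rewrite indicE mem_setE -/b tb.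
Qed.

End inverse_spectral_integral.

(** * The converse result: a convergence rate implies a source condition *)

Theorem lemma4p10 (R : realType) (k : scalar_kind) (X Y : hilbert R k)
    (T : {linear X -> Y}) (Tstar : {linear Y -> X}) (E : spectral_family X)
    (alpha0 : R) (g : R -> R -> R) (Ra : R -> Y -> X)
    (rho : R -> R) (beta : R) (x : X) :
  infinite_dimensional X -> infinite_dimensional Y ->
  continuous T -> injective T -> ~ closed (range T) ->
  is_adjoint T Tstar ->
  is_spectral_family_of E (fun v => Tstar (T v)) ->
  0 < alpha0 <= opnorm T ^+ 2 ->
  spectral_regularization T Tstar E alpha0 g Ra ->
  {in `]0, opnorm T ^+ 2] &, {homo rho : l m / l < m}} ->
  {within `]0, opnorm T ^+ 2], continuous rho} ->
  local_upper_type (opnorm T ^+ 2) rho beta ->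
  maximal_qualification (opnorm T ^+ 2) alpha0 g rho ->
  (exists a kappa : R, [/\ 0 < a, 0 < kappa &
    forall al l, al \in `]0, alpha0[ -> kappa * al <= l <= opnorm T ^+ 2 ->
      a <= rho l * `|residual g al l| / rho al]) ->
  (fun al => hnorm (Ra al (T x) - x)) =O_ (0^'+) rho ->
  exists w : X, spectral_integral E `]0, opnorm T ^+ 2] rho w x.
Proof.
move=> _ _ cT injT _ adjT ET /andP[a0 a0b] [[_ [C _ gC] _] RaE] _ crho _.
move=> [[rho_gt0 rho_le _] _] [a [kappa [a_gt0 kappa_gt0 lower]]] /eqO_exP[D D0 RaD].
set b := opnorm T ^+ 2 in a0b gC RaE crho rho_gt0 rho_le lower *.
have b0 : 0 < b by exact: lt_le_trans a0b.
have mrho : measurable_fun (`]0, b] : set R) rho.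
  by apply: subspace_continuous_measurable_fun => //; exact: measurable_itv.
(* K = (D / a)^2 results from a^2 rho(al)^2 / rho^2 <= r_al^2 on [kappa al, b], where r_al^2 has
   integral at most D^2 rho(al)^2: the factor rho(al)^2 cancels. *)
apply: (spectral_integral_preimage cT injT adjT ET (K := D ^+ 2 / a ^+ 2) b0 rho_gt0 rho_le mrho) => n.
(* Given n, al is taken so small that ]1/(n+1), b] lies in [kappa al, b], where the residual is
   bounded below. K does not depend on this choice. *)
have [al [al0 aln alD]] : exists al, [/\ al \in `]0, alpha0[, kappa * al <= n.+1%:R^-1 &
    hnorm (Ra al (T x) - x) <= D * rho al].
  near (0 : R)^'+ => al.
  have al0 : al \in `]0, alpha0[ by rewrite in_itv /=; apply/andP; split; near: al;
    [exact: nbhs_right_gt|exact: nbhs_right_lt].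
  exists al; split => //.
    rewrite mulrC -ler_pdivlMr //; near: al; apply: nbhs_right_le.
    by rewrite divr_gt0 ?invr_gt0.
  have : `|hnorm (Ra al (T x) - x)| <= D * `|rho al| by near: al.
  rewrite ger0_norm ?hnorm_ge0 // ger0_norm // ltW // rho_gt0 //.
  by move: al0; rewrite !in_itv /= => /andP[-> /ltW/le_trans->].
have alb : al \in `]0, b].
  by move: al0; rewrite !in_itv /= => /andP[-> /ltW/le_trans->].
have ral := rho_gt0 _ alb.
have al_gt0 : 0 < al by move: al0; rewrite in_itv /= => /andP[].
have [le1 br] := sint_residual_sqr_le ET (mulr_gt0 kappa_gt0 al_gt0)
  (gC _ al0) (RaE _ al0 (T x)).
have bphi : bmeas (inv_trunc b rho n \* inv_trunc b rho n).
  by apply: bmeasM; exact: (bmeas_inv_trunc b0 rho_gt0 rho_le mrho).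
(* Clearing denominators, it remains to bound the integral of (a rho(al) / rho)^2 over ]1/(n+1), b]
   by (D rho(al))^2. *)
rewrite ler_pdivlMr ?exprn_gt0 // -(@ler_pM2r _ (rho al ^+ 2)) ?exprn_gt0 //.
rewrite -mulrA -exprMn [leLHS]mulrC -sintZ //.
apply: (@le_trans _ _ (hnorm (Ra al (T x) - x) ^+ 2)); last first.
  by rewrite -exprMn lerXn2r ?nnegrE ?hnorm_ge0 // mulr_ge0 // ltW.
apply: le_trans le1; apply: le_sint => // [|t]; first exact: bmeasZ.
rewrite /= inv_truncE indicE mem_setE -/b.
have [tb|_] := boolP (t \in `]n.+1%:R^-1, b]); last first.
  by rewrite !mulr0 mulr_ge0 ?sqr_ge0.
have t0 := itv_inv_trunc tb.
have kt : t \in `[kappa * al, b].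
  by move: tb; rewrite !in_itv /= => /andP[nt ->]; rewrite (le_trans aln (ltW nt)).
rewrite kt mulr1 -(real_normK (num_real (1 - _))) -/(residual g al t).
have rt := rho_gt0 _ t0.
have aphi : 0 <= a * rho al / rho t by rewrite divr_ge0 ?mulr_ge0 ?(ltW a_gt0) ?(ltW ral) ?(ltW rt).
rewrite -[X in _ * X]expr2 -exprMn lerXn2r ?nnegrE //.
rewrite ler_pdivrMr ?rho_gt0 // -ler_pdivlMr // [X in _ <= X / _]mulrC.
by apply: lower => //; move: kt; rewrite in_itv.
Unshelve. all: by end_near. Qed.
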